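(* There exists a linear-time algorithm (linear in the order of the input tree) which, given a tree $T$, computes the minimum cost $\gamma_{B_2}(T)$ of a dominating $2$-broadcast on $T$. Moreover, a dominating $2$-broadcast $f$ on $T$ attaining this minimum cost can also be constructed in linear time.
   Context: Graphs are finite, undirected, simple and connected; $d(u,v)$ denotes the graph distance. A dominating $2$-broadcast on a graph $G$ is a function $f\colon V(G)\to\{0,1,2\}$ such that for every $u\in V(G)$ there is a vertex $v\in V(G)$ with $f(v)\ge 1$ and $d(u,v)\le f(v)$. Its cost is $\omega(f)=\sum_{v\in V(G)} f(v)$, and $\gamma_{B_2}(G)$ is the minimum cost of a dominating $2$-broadcast on $G$. *)

(* Defs.v *)
From mathcomp Require Import all_boot.

Set Implicit Arguments.
Unset Strict Implicit.
Unset Printing Implicit Defensive.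

Record sgraph (V : finType) := SGraph {
  adj : rel V;
  adj_sym : symmetric adj;
  adj_irrefl : irreflexive adj
}.

Section Graphs.

Variables (V : finType) (G : sgraph V).

Definition connected : bool :=
  (0 < #|V|) && [forall u, forall v, connect (adj G) u v].

(* [ucycle] accepts the empty sequence and the two ends of an edge, which are
   not cycles of a simple graph. *)
Definition acyclic : Prop := forall c : seq V, 2 < size c -> ~ ucycle (adj G) c.

Definition is_tree : Prop := connected /\ acyclic.

Definition has_walk (u v : V) (k : nat) : bool :=
  [exists p : k.-tuple V, path (adj G) u p && (last u p == v)].

(* The least length of a walk from u to v; the value is #|V| if there is none,
   which does not happen in a connected graph. *)
Definition dist (u v : V) : nat := find (has_walk u v) (iota 0 #|V|).

Lemma dist_has_walk u v : connect (adj G) u v -> has_walk u v (dist u v).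
Proof.
case/connectP=> p0 p0_path ->.
case/shortenP: p0_path => p p_path p_uniq _.
have szp : size p < #|V| by have:= uniq_leq_size p_uniq (fun x _ => mem_enum V x);
  rewrite -cardE.
have hasw : has (has_walk u (last u p)) (iota 0 #|V|).
  apply/hasP; exists (size p); first by rewrite mem_iota.
  by apply/existsP; exists (in_tuple p); rewrite /= p_path eqxx.
have := nth_find 0 hasw; rewrite nth_iota //.
by move: hasw; rewrite has_find size_iota.
Qed.

Lemma dist_min u v p :
  path (adj G) u p -> last u p = v -> dist u v <= size p.
Proof.
move=> p_path p_last; rewrite leqNgt; apply/negP => lt_p.
have szp : size p < #|V|.
  by apply: leq_trans lt_p _; rewrite -[leqRHS](size_iota 0) find_size.
have := before_find 0 lt_p; rewrite nth_iota // add0n => /existsP[].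
by exists (in_tuple p); rewrite /= p_path p_last eqxx.
Qed.

Definition dominating (f : {ffun V -> 'I_3}) : bool :=
  [forall u, exists v, (1 <= f v) && (dist u v <= f v)].

Definition cost (f : {ffun V -> 'I_3}) : nat := \sum_v f v.

Definition all_one : {ffun V -> 'I_3} := [ffun=> inord 1].

Definition gammaB2 : nat :=
  cost [arg min_(f < all_one | dominating f) cost f].

Lemma dominating_all_one : dominating all_one.
Proof.
apply/forallP=> u; apply/existsP; exists u; rewrite ffunE inordK //=.
exact: leq_trans (@dist_min u u [::] isT erefl) _.
Qed.

Lemma gammaB2P :
  (exists2 f, dominating f & cost f = gammaB2) /\
  (forall f, dominating f -> gammaB2 <= cost f).
Proof.
rewrite /gammaB2; case: arg_minnP => [|f f_dom f_min].
  exact: dominating_all_one.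
by split; first exists f.
Qed.

(* es lists every edge exactly once, in an arbitrary order and with an
   arbitrary orientation. *)
Definition edge_list (es : seq (V * V)) : Prop :=
  [/\ uniq es,
      forall u v, adj G u v = ((u, v) \in es) || ((v, u) \in es)
    & forall u v, (u, v) \in es -> (v, u) \notin es].

End Graphs.

(* A word random-access machine with structured control flow. It has registers
   and an indirectly addressed memory (heap), both indexed by nat. In the
   instructions r, a and b are registers; heap[a] is the cell whose address is
   the content of a. W is the largest number that fits in a word; an
   instruction whose result exceeds W has no transition. *)

Inductive instr :=
| IConst (r c : nat)     (* r := c, a constant *)
| IMove (r a : nat)      (* r := a *)
| IAdd (r a b : nat)     (* r := a + b *)
| ISub (r a b : nat)     (* r := a - b, truncated at 0 *)
| ILoad (r a : nat)      (* r := heap[a] *)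
| IStore (a b : nat).    (* heap[a] := b *)

Inductive cmd :=
| CSkip
| CInstr (i : instr)
| CSeq (p q : cmd)
| CIf (r : nat) (p q : cmd)   (* p if register r is nonzero, q otherwise *)
| CWhile (r : nat) (p : cmd). (* while register r is nonzero *)

Record state := State { regs : nat -> nat; heap : nat -> nat }.

Definition set_reg (W : nat) (s : state) (r x : nat) : option state :=
  if x <= W then Some (State [eta regs s with r |-> x] (heap s)) else None.

Definition step (W : nat) (i : instr) (s : state) : option state :=
  match i with
  | IConst r c => set_reg W s r c
  | IMove r a => set_reg W s r (regs s a)
  | IAdd r a b => set_reg W s r (regs s a + regs s b)
  | ISub r a b => set_reg W s r (regs s a - regs s b)
  | ILoad r a => set_reg W s r (heap s (regs s a))
  | IStore a b => Some (State (regs s) [eta heap s with regs s a |-> regs s b])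
  end.

(* exec W p s t s' : started in state s, the program p halts in state s' after
   exactly t unit-cost operations (instructions and tests of CIf and CWhile). *)
Inductive exec (W : nat) : cmd -> state -> nat -> state -> Prop :=
| ExecSkip s : exec W CSkip s 0 s
| ExecInstr i s s' : step W i s = Some s' -> exec W (CInstr i) s 1 s'
| ExecSeq p q s1 s2 s3 t1 t2 :
    exec W p s1 t1 s2 -> exec W q s2 t2 s3 -> exec W (CSeq p q) s1 (t1 + t2) s3
| ExecIfTrue r p q s s' t :
    regs s r != 0 -> exec W p s t s' -> exec W (CIf r p q) s t.+1 s'
| ExecIfFalse r p q s s' t :
    regs s r = 0 -> exec W q s t s' -> exec W (CIf r p q) s t.+1 s'
| ExecWhileTrue r p s1 s2 s3 t1 t2 :
    regs s1 r != 0 -> exec W p s1 t1 s2 -> exec W (CWhile r p) s2 t2 s3 ->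
    exec W (CWhile r p) s1 (t1 + t2).+1 s3
| ExecWhileFalse r p s : regs s r = 0 -> exec W (CWhile r p) s 1 s.

Lemma exec_det W p s t1 s1 t2 s2 :
  exec W p s t1 s1 -> exec W p s t2 s2 -> t1 = t2 /\ s1 = s2.
Proof.
move=> E; elim: E t2 s2 => {p s t1 s1}.
- by move=> s t2 s2 E; inversion E.
- by move=> i s s' st t2 s2 E; inversion_clear E as [|? ? ? st'| | | | |];
    move: st'; rewrite st => -[->].
- move=> p q s1 s2 s3 t1 t2 _ IHp _ IHq t s E.
  inversion_clear E as [| |? ? ? s2' ? ? ? Ep Eq| | | |].
  by case: (IHp _ _ Ep) => -> eq_s; subst s2'; case: (IHq _ _ Eq) => -> ->.
- move=> r p q s s' t nz _ IH t2 s2 E.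
  inversion_clear E as [| | |? ? ? ? ? ? _ Ep|? ? ? ? ? ? z _| |].
    by case: (IH _ _ Ep) => -> ->.
  by rewrite z in nz.
- move=> r p q s s' t z _ IH t2 s2 E.
  inversion_clear E as [| | |? ? ? ? ? ? nz _|? ? ? ? ? ? _ Eq| |].
    by rewrite z in nz.
  by case: (IH _ _ Eq) => -> ->.
- move=> r p s1 s2 s3 t1 t2 nz _ IHp _ IHw t s E.
  inversion E as [| | | | |? ? ? s2' ? ? ? _ Ep Ew|? ? ? z]; subst.
    by case: (IHp _ _ Ep) => -> eq_s; subst s2'; case: (IHw _ _ Ew) => -> ->.
  by rewrite z in nz.
- move=> r p s z t2 s2 E.
  inversion E as [| | | | |? ? ? ? ? ? ? nz|]; subst => //.
  by rewrite z in nz.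
Qed.

(* The memory initially holds n, u_1, v_1, ..., u_m, v_m from address 0 on,
   where es = (u_1, v_1), ..., (u_m, v_m); everything else is 0. *)
Definition init (n : nat) (es : seq ('I_n * 'I_n)) : state :=
  State (fun=> 0)
        (nth 0 (n :: flatten [seq [:: val e.1; val e.2] | e <- es])).

(* A single program answers correctly on all trees, of any order n, in at most
   c * n operations, on words of O(log n) bits: any W >= (n + 1) ^ k will do.
   The answer is read off the final memory. *)
Definition linear_time_on_trees
    (answer : forall n, sgraph 'I_n -> (nat -> nat) -> Prop) : Prop :=
  exists (p : cmd) (c k : nat),
    forall (n : nat) (T : sgraph 'I_n) (es : seq ('I_n * 'I_n)) (W : nat),
      is_tree T -> edge_list T es -> n.+1 ^ k <= W ->
      exists (t : nat) (s : state),
        [/\ exec W p (init es) t s, t <= c * n & answer n T (heap s)].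

(* Main.v *)
Require Import Defs.
From mathcomp Require Import all_boot zify.
From Stdlib Require Import FunctionalExtensionality.

(** The algorithm prunes leaves. Every vertex [v] carries a level [x v] in
    0..4 that summarises the part of the tree already pruned into it: a level
    of at least 2 means that [v] hears a broadcast, with strength [x v - 2]
    left over; level 1 means that [v] still has to be reached; level 0 means
    that a neighbour of [v], already pruned, can only be reached through [v],
    by a broadcast that still has strength 1 at [v].
    Pruning a leaf [u] with neighbour [p] replaces the level of [p] by
    [absorb (x p) (x u)], or shows that the labelling is hopeless. The
    predicate [settled] says, on the vertices that remain, that every unmet
    demand is met by a remaining vertex at distance at most 2. On the whole
    tree it means domination ([dominatingP]), on a single vertex it means that
    the level is at least 2 ([settled1]), and pruning a leaf preserves it in
    both directions ([settled_leafW], [settled_leafV]).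

    Each remaining vertex also has a table, which gives for each level the least
    cost of reaching it (a large constant if there is no way). Pruning merges
    two tables along [absorb]. The sum of the table entries along an optimal
    labelling never increases ([lower_merged]), so that the last vertex has an
    admissible entry of at most gamma. Conversely a labelling of the remaining
    vertices is lifted through one pruning step, at equal table sum, by the
    pair of levels recorded for the minimum ([solves_merged]); lifting it back to
    the whole tree yields a dominating broadcast whose cost is the entry.

    A leaf is found without adjacency lists: the program keeps the degree of
    each remaining vertex and the sum of its remaining neighbours, so that for
    a leaf the sum is its neighbour. A queue holds the leaves. A tree with
    at least two vertices has a leaf ([exists_leaf]), and a tree has n - 1 edges
    ([size_edge_list]), hence all loops are counted loops of at most n rounds. Their bodies contain no
    loop, so a static bound on the number of steps of the bodies
    ([exec_max_steps]) gives linear time ([runs_loop]); the rest of the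
    verification is about final states only ([halts]). *)

Set Implicit Arguments.
Unset Strict Implicit.
Unset Printing Implicit Defensive.

(** * Leaves of a tree *)

Section LeafPruning.

Variables (V : finType) (G : sgraph V).
Implicit Types (X : {set V}) (u v w p : V).

Definition nbrs X v : {set V} := [set w in X | adj G v w].

Definition induced X : rel V := [rel x y | [&& x \in X, y \in X & adj G x y]].

Definition connected_in X : Prop := {in X &, forall a b, connect (induced X) a b}.

Definition leaf X u p : Prop :=
  [/\ u \in X, p \in X & {in X, forall w, adj G u w = (w == p)}].

Lemma leaf_neq X u p : leaf X u p -> u != p.
Proof.
by case=> uX pX uP; apply/eqP => up; have := uP p pX; rewrite -up adj_irrefl eqxx.
Qed.

Lemma leaf_of_nbrs1 X u : u \in X -> #|nbrs X u| = 1 ->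
  exists2 p, leaf X u p & nbrs X u = [set p].
Proof.
move=> uX /eqP/cards1P[p nE]; exists p => //; split=> // [|w wX].
  by have := set11 p; rewrite -nE inE => /andP[].
by have := in_set1 w p; rewrite -nE inE wX.
Qed.

Lemma nbrs_gt0 X v : connected_in X -> 1 < #|X| -> v \in X -> 0 < #|nbrs X v|.
Proof.
move=> cX X2 vX.
have [w wX wv] : exists2 w, w \in X & w != v.
  move: X2; rewrite (cardsD1 v) vX ltnS => /card_gt0P[w].
  by rewrite in_setD1 => /andP[wv wX]; exists w.
case/connectP: (cX v w vX wX) => -[|x q] /=; first by move=> _ wE; rewrite wE eqxx in wv.
case/andP=> /and3P[_ xX vx] _ _; apply/card_gt0P; exists x.
by rewrite inE xX.
Qed.

(** Sending [u] to [p] and fixing the other vertices turns a walk in [X] into a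
    walk in [X :\ u], up to steps that stay in place. *)
Lemma connected_in_leaf X u p :
  leaf X u p -> connected_in X -> connected_in (X :\ u).
Proof.
move=> lf cX; have [uX pX uP] := lf; have upN := leaf_neq lf.
pose phi x := if x == u then p else x.
have phiE x : x != u -> phi x = x by rewrite /phi => /negbTE->.
have step q : forall x, path (induced X) x q ->
    connect (induced (X :\ u)) (phi x) (phi (last x q)).
  elim: q => [|y q IH] x //= /andP[/and3P[xX yX xy] /IH]; apply: connect_trans.
  rewrite /phi; have [xu|xu] := eqVneq x u; have [yu|yu] := eqVneq y u.
  - exact: connect0.
  - by move: xy; rewrite xu uP // => /eqP->; apply: connect0.
  - by move: xy; rewrite yu adj_sym uP // => /eqP->; apply: connect0.
  - by apply: connect1; rewrite /induced /= !inE xu yu xX yX.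
move=> a b; rewrite !inE => /andP[au aX] /andP[bu bX].
case/connectP: (cX a b aX bX) => q /step + bE; rewrite -bE !phiE //.
Qed.

(** An end of a longest path is a leaf: all its neighbours lie on the path, and
    a neighbour other than the next vertex of the path would close a cycle. *)
Lemma exists_leaf X : acyclic G -> connected_in X -> 1 < #|X| ->
  exists2 u, u \in X & #|nbrs X u| = 1.
Proof.
move=> acG cX X2.
pose good k := [exists t : k.-tuple V, [&& uniq t, sorted (adj G) t & all (mem X) t]].
have good0 : exists k, good k.
  by exists 0; apply/existsP; exists [tuple].
have good_le k : good k -> k <= #|X|.
  case/existsP=> t /and3P[tu _ /allP tX]; rewrite -(size_tuple t).
  by rewrite -(card_uniqP tu); apply/subset_leq_card/subsetP.
case: (ex_maxnP good0 good_le) => k /existsP[t /and3P[t_u t_path t_X]] k_max.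
have long (s : seq V) : uniq s -> sorted (adj G) s -> all (mem X) s -> size s <= k.
  by move=> su sp sX; apply/k_max/existsP; exists (in_tuple s); rewrite su sp.
rewrite -(size_tuple t) in long; case: {t}(val t) t_u t_path t_X long => [|x q].
  move=> _ _ _ long; have [x xX] : exists x, x \in X.
    by apply/card_gt0P; apply: ltnW.
  by have := long [:: x]; rewrite /= xX => /(_ isT isT isT).
move=> /= /andP[xq q_u] xq_path /andP[xX q_X] long; exists x => //.
apply/eqP; rewrite eqn_leq nbrs_gt0 // andbT leqNgt; apply/negP => nb2.
have xNx w : adj G x w -> w != x by apply: contraTneq => ->; rewrite adj_irrefl.
have in_q w : w \in X -> adj G x w -> w \in q.
  move=> wX xw; apply/negPn/negP => wq.
  have := long (w :: x :: q).
  rewrite /= !inE negb_or (xNx w xw) wq xq q_u adj_sym xw xq_path wX xX q_X.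
  by move=> /(_ isT isT isT); rewrite ltnn.
have [z zX [xz z_ne]] : exists2 z, z \in X & adj G x z /\ z != head x q.
  move: nb2; rewrite (cardsD1 (head x q)) => nb2.
  have : 0 < #|nbrs X x :\ head x q| by move: nb2; case: (_ \in _) => /=; lia.
  by case/card_gt0P=> z; rewrite !inE => /and3P[? ? ?]; exists z.
have /splitPr q_split := in_q z zX xz.
case: q_split xq q_u xq_path z_ne => [[|y q1] q2]; first by rewrite /= eqxx.
move=> xq q_u xq_path _.
apply: (acG (x :: rcons (y :: q1) z)); first by rewrite /= size_rcons.
move: xq q_u xq_path; rewrite -cat_rcons cat_path mem_cat negb_or cat_uniq.
move=> /andP[xq _] /andP[q_u _] /andP[q_path _].
rewrite /ucycle /cycle rcons_path q_path last_rcons adj_sym xz /=.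
by rewrite -/(uniq (y :: rcons q1 z)) -[in X in _ && X]rcons_cons q_u andbT.
Qed.

Lemma nbrsD1 X u p v : leaf X u p -> v \in X :\ u ->
  nbrs (X :\ u) v = if v == p then nbrs X p :\ u else nbrs X v.
Proof.
case=> uX pX uP; rewrite !inE => /andP[vu vX]; apply/setP=> w.
case: (eqVneq v p) => [->|vp]; rewrite !inE; first by rewrite andbA.
have [->|] //= := eqVneq w u.
by rewrite adj_sym uP // (negbTE vp) andbF.
Qed.

Lemma card_nbrsD1 X u p v : leaf X u p -> v \in X :\ u ->
  #|nbrs X v| = #|nbrs (X :\ u) v| + (v == p).
Proof.
move=> lf vX; rewrite (nbrsD1 lf vX); have [uX pX uP] := lf.
have [->|] := eqVneq v p; last by rewrite addn0.
by rewrite [LHS](cardsD1 u) inE uX adj_sym uP // eqxx addnC.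
Qed.

(** Each edge is counted at both ends, and pruning a leaf removes one edge. *)
Lemma sum_card_nbrs X : acyclic G -> connected_in X -> 0 < #|X| ->
  \sum_(v in X) #|nbrs X v| = (#|X|.-1).*2.
Proof.
move=> acG; move sX : #|X|.-1 => k; elim: k X sX => [|k IH] X sX cX X0.
  have /eqP/cards1P[x ->] : #|X| = 1 by lia.
  rewrite big_set1; apply/eqP; rewrite cards_eq0; apply/eqP/setP=> w.
  by rewrite !inE; case: eqVneq => // ->; rewrite adj_irrefl.
have [|u uX u1] := exists_leaf acG cX; first by lia.
have [p lf _] := leaf_of_nbrs1 uX u1; have [_ pX _] := lf.
have cardX := cardsD1 u X; rewrite uX in cardX.
have {}IH := IH (X :\ u) _ (connected_in_leaf lf cX) _.
rewrite (big_setD1 u) //= u1.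
rewrite (eq_bigr _ (fun v vX => card_nbrsD1 lf vX)) big_split /= IH; try lia.
rewrite (bigD1 p) /=; last by rewrite !inE eq_sym (leaf_neq lf).
by rewrite eqxx big1 => [|i /andP[_ /negbTE->]] //; lia.
Qed.

End LeafPruning.

(** * Levels and leaf removal *)

(** Seen from [p], level [xu] of the leaf becomes [xu - 1], both as a strength
    and as a demand; a demand of level 0 at [u] would become negative, which
    only a broadcast of full strength at [p] can meet. If one side meets
    the demand of the other, or none has a demand, which is the case
    [4 <= xp + xu], the stronger level remains, and otherwise the more
    demanding one. *)
Definition absorb (xp xu : nat) : option nat :=
  if 4 <= xp + xu then Some (maxn xp xu.-1)
  else if xu == 0 then None else Some (minn xp xu.-1).

Lemma absorb_Some xp xu m : absorb xp xu = Some m ->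
  4 <= xp + xu /\ m = maxn xp xu.-1
  \/ [/\ xp + xu < 4, 0 < xu & m = minn xp xu.-1].
Proof.
rewrite /absorb; case: (leqP 4 (xp + xu)) => h /=; first by case=> <-; left.
by case: (posnP xu) => //= u0; case=> <-; right.
Qed.

Lemma absorb_lt5 xp xu m : xp < 5 -> xu < 5 -> absorb xp xu = Some m -> m < 5.
Proof. by move=> hp hu /absorb_Some[[]|[]]; lia. Qed.

Section Levels.

Variables (V : finType) (G : sgraph V).
Implicit Types (X : {set V}) (x : V -> nat).

(** [w] meets the demand of [v] at distance [d] when [d + 3 <= x w + x v]. Levels
    are at most 4, so only the distances 1 and 2 can occur for a demanding
    [v]. *)
Definition helps X x w v : bool :=
  adj G v w && (4 <= x w + x v)
  || [exists z in X, adj G v z && adj G z w] && (5 <= x w + x v).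

Definition settled X x : Prop :=
  {in X, forall v, 2 <= x v \/ exists2 w, w \in X & helps X x w v}.

Variables (X : {set V}) (u p : V) (x x' : V -> nat).
Hypotheses (lf : leaf G X u p) (x_lt : {in X, forall v, x v < 5})
  (x'E : {in X :\ u, forall v, v != p -> x' v = x v}).

Lemma settled_leaf_None : absorb (x p) (x u) = None -> ~ settled X x.
Proof.
have [uX pX uP] := lf; move=> mN Dx.
have [xu0 xp] : x u = 0 /\ x p < 4.
  by move: mN; rewrite /absorb; do 2!case: ifP => //; lia.
have [|[w wX]] := Dx u uX; first lia.
have xw := x_lt wX; rewrite /helps uP // => /orP[|/andP[_]]; last lia.
by case/andP=> /eqP->; lia.
Qed.

Hypothesis m_eq : absorb (x p) (x u) = Some (x' p).

(** A vertex helped by [u] is a neighbour of [p], and is then helped by the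
    new level of [p]. If [p] takes over the demand of [u], whoever helped [u]
    at distance 2 is a neighbour of [p]. *)
Lemma settled_leafW : settled X x -> settled (X :\ u) x'.
Proof.
have [uX pX uP] := lf; have upN := leaf_neq lf.
have uP' w : w \in X -> adj G w u = (w == p) by rewrite adj_sym; apply: uP.
have xu := x_lt uX; have xp := x_lt pX.
move=> Dx v; rewrite !inE => /andP[vu vX]; have xv := x_lt vX.
have two w : v != p -> w != u ->
    [exists z in X, adj G v z && adj G z w] ->
    [exists z in X :\ u, adj G v z && adj G z w].
  move=> vp wu /exists_inP[z zX /andP[vz zw]]; apply/exists_inP; exists z; last by rewrite vz.
  by rewrite !inE zX andbT; apply: contraNneq vp => zu; rewrite -uP' -?zu.
have [vp|vp] := eqVneq v p; last first.
  have x'v : x' v = x v by rewrite x'E ?inE ?vu.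
  rewrite x'v; have [|xv2] := leqP 2 (x v); first by left.
  have [|[w wX hw]] := Dx v vX; first lia.
  have xw := x_lt wX.
  have [wu|wu] := eqVneq w u.
    subst w; move: hw; rewrite /helps uP' // (negbTE vp) /=.
    case/andP=> /exists_inP[z zX /andP[vz]]; rewrite uP' // => /eqP zp h5; subst z.
    right; exists p; first by rewrite !inE eq_sym upN.
    apply/orP; left; rewrite vz x'v /=.
    by case: (absorb_Some m_eq) => -[]; clear -h5 xv2 xu; lia.
  have [wp|wp] := eqVneq w p; last first.
    right; exists w; first by rewrite !inE wu.
    rewrite /helps x'v x'E ?inE ?wu //; apply/orP.
    case/orP: hw => [|/andP[/two h h5]]; first by left.
    by right; rewrite h.
  subst w; have x'p : 3 <= x p -> x p <= x' p.
    by case: (absorb_Some m_eq) => -[]; clear; lia.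
  right; exists p; first by rewrite !inE wu.
  rewrite /helps x'v; apply/orP; case/orP: hw => /andP[h1 h2]; [left|right].
    by rewrite h1 /= (leq_trans h2) // leq_add2r x'p //; clear -h2 xv2; lia.
  by rewrite two //= (leq_trans h2) // leq_add2r x'p //; clear -h2 xv2; lia.
subst v; have [|m2] := leqP 2 (x' p); [by left | right].
have [sum4 u0 mE] : [/\ x p + x u < 4, 0 < x u & x' p = minn (x p) (x u).-1].
  by case: (absorb_Some m_eq) => -[] *; split=> //; lia.
have [mp|mu] := leqP (x p) (x u).-1.
  have [|[w wX hw]] := Dx p pX; first lia.
  have wu : w != u.
    by apply: contraTneq hw => ->; rewrite /helps; clear -sum4; lia.
  exists w; first by rewrite !inE wu.
  have wp : w != p.
    by apply: contraTneq hw => ->; rewrite /helps; clear -m2 mp mE; lia.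
  rewrite /helps (x'E _ wp) ?inE ?wu // mE (minn_idPl mp).
  case/orP: hw => [->//|/andP[/exists_inP[z zX /andP[pz zw]] h5]].
  apply/orP; right; rewrite h5 andbT; apply/exists_inP; exists z; last by rewrite pz.
  rewrite !inE zX andbT; apply: contraTneq zw => ->.
  by rewrite uP // (negbTE wp).
have xu1 : x u = 1 by lia.
have [|[w wX hw]] := Dx u uX; first lia.
have xw := x_lt wX; move: hw; rewrite /helps uP //.
have [wp|wp] /= := eqVneq w p.
  by subst w; case/orP=> [|/andP[_]]; lia.
case/andP=> /exists_inP[z zX /andP[]]; rewrite uP // => /eqP-> pw h5.
have wu : w != u by apply: contraTneq h5 => ->; clear -xu1; lia.
exists w; first by rewrite !inE wu.
by rewrite /helps (x'E _ wp) ?inE ?wu // pw /=; clear -h5 xu1; lia.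
Qed.

(** The new level of [p] is the old one, or one less than that of [u]: in the
    second case its help comes from [u], and its demand is that of [u]. *)
Lemma settled_leafV : settled (X :\ u) x' -> settled X x.
Proof.
have [uX pX uP] := lf; have upN := leaf_neq lf.
have uP' w : w \in X -> adj G w u = (w == p) by rewrite adj_sym; apply: uP.
have xu := x_lt uX; have xp := x_lt pX.
have pX' : p \in X :\ u by rewrite !inE eq_sym upN.
have m5 := absorb_lt5 xp xu m_eq.
move=> Dx v vX; have xv := x_lt vX.
have [|v2] := leqP 2 (x v); [by left | right].
have [vu|vu] := eqVneq v u.
  subst v; have [p4|p4] := leqP 4 (x p + x u).
    by exists p => //; rewrite /helps uP // eqxx p4.
  have [xu1 m0] : x u = 1 /\ x' p = 0.
    by case: (absorb_Some m_eq) => -[]; clear -p4 v2; lia.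
  have [|[w wX']] := Dx p pX'; first lia.
  move: (wX'); rewrite !inE => /andP[wu wX]; have xw := x_lt wX.
  have [->|wp] := eqVneq w p; first by rewrite /helps m0; clear; lia.
  rewrite /helps x'E // m0 => /orP[/andP[pw h4]|/andP[_]]; last by clear -xw; lia.
  exists w => //; apply/orP; right; apply/andP; split; last by clear -h4 xu1; lia.
  by apply/exists_inP; exists p => //; rewrite uP // eqxx.
have [vp|vp] := eqVneq v p.
  subst v; have [p4|p4] := leqP 4 (x p + x u).
    by exists u => //; rewrite /helps uP' // eqxx addnC p4.
  have mp : x' p <= x p.
    by case: (absorb_Some m_eq) => -[]; clear -p4; lia.
  have [|[w wX']] := Dx p pX'; first lia.
  move: (wX'); rewrite !inE => /andP[wu wX].
  have [->|wp] := eqVneq w p; first by rewrite /helps; clear -mp v2; lia.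
  rewrite /helps x'E // => hw; exists w => //; rewrite /helps.
  case/orP: hw => [/andP[-> h4]|/andP[/exists_inP[z]]].
    by apply/orP; left => /=; clear -h4 mp; lia.
  rewrite !inE => /andP[zu zX] pzw h5; apply/orP; right.
  apply/andP; split; last by clear -h5 mp; lia.
  by apply/exists_inP; exists z.
have vX' : v \in X :\ u by rewrite !inE vu.
have [|[w wX']] := Dx v vX'; first by rewrite x'E //; clear -v2; lia.
move: (wX'); rewrite !inE => /andP[wu wX]; have xw := x_lt wX.
have twoW w1 : [exists z in X :\ u, adj G v z && adj G z w1] ->
    [exists z in X, adj G v z && adj G z w1].
  case/exists_inP=> z; rewrite !inE => /andP[_ zX] vzw.
  by apply/exists_inP; exists z.
rewrite /helps (x'E vX' vp).
have [wp|wp] := eqVneq w p; last first.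
  rewrite x'E // => hw; exists w => //; rewrite /helps.
  by case/orP: hw => [->//|/andP[/twoW-> ->]]; rewrite orbT.
subst w => hw; have m3 : 3 <= x' p by move: hw; clear -v2; lia.
have p4 : 4 <= x p + x u by case: (absorb_Some m_eq) => -[]; clear -m3; lia.
have mE : x' p = maxn (x p) (x u).-1 by case: (absorb_Some m_eq) => -[] //; clear -p4; lia.
have [mp|mu] := leqP (x u).-1 (x p).
  exists p => //; rewrite /helps; move: hw; rewrite mE (maxn_idPl mp).
  by case/orP=> [->//|/andP[/twoW-> ->]]; rewrite orbT.
have {}mE : x' p = (x u).-1 by rewrite mE; apply/maxn_idPr; clear -mu; lia.
case/orP: hw => /andP[h1 h2]; last by clear -h2 mE xu v2; lia.
exists u => //; apply/orP; right; apply/andP; split; last by clear -h2 mE mu; lia.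
by apply/exists_inP; exists p => //; rewrite h1 uP' // eqxx.
Qed.

End Levels.

Lemma settled1 (V : finType) (G : sgraph V) r (x : V -> nat) :
  x r < 5 -> settled G [set r] x <-> 2 <= x r.
Proof.
move=> xr; split=> [D|xr2 v]; last by rewrite inE => /eqP->; left.
have [//|[w]] := D r (set11 r); rewrite inE => /eqP->.
by rewrite /helps adj_irrefl; lia.
Qed.

(** The level of a vertex of broadcast value [k] before any pruning. *)
Definition level0 (k : nat) : nat := if k == 0 then 1 else k.+2.

(** At distance [d] from a vertex of value [k > 0], a vertex of value 0 is
    helped when [d + 3 <= (k + 2) + 1], that is [d <= k]. *)
Lemma dominatingP (V : finType) (G : sgraph V) (f : {ffun V -> 'I_3}) :
  connected G -> dominating G f <-> settled G setT (fun v => level0 (f v)).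
Proof.
case/andP=> _ cG.
have walk u v : has_walk G u v (dist G u v).
  by apply: dist_has_walk; move/forallP/(_ u)/forallP: cG.
split=> [/forallP domf v _|Df].
  have /existsP[w /andP[w1 dw]] := domf v; have fw := ltn_ord (f w).
  rewrite /level0; have [fv|fv] := eqVneq (nat_of_ord (f v)) 0; last by left; lia.
  right; exists w => //; rewrite /helps fv /= (negbTE (_ : (f w : nat) != 0)); last by lia.
  have := walk v w; move: (dist G v w) dw => [|[|[|d]]] dw /existsP[t]; last lia.
  - by rewrite tuple0 /= => /eqP vw; move: w1; rewrite -vw fv.
  - case/tupleP: t => z t; rewrite tuple0 /= andbT => /andP[vz /eqP zw].
    by subst z; rewrite vz; apply/orP; left => /=; lia.
  - case/tupleP: t => z t; case/tupleP: t => y t; rewrite tuple0 /= andbT.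
    case/andP=> vzy /eqP yw; subst y; apply/orP; right; apply/andP; split; last lia.
    by apply/exists_inP; exists z.
apply/forallP=> v; apply/existsP; have := Df v (in_setT v).
rewrite /level0; have [fv|fv] := eqVneq (nat_of_ord (f v)) 0; last first.
  move=> _; exists v; rewrite lt0n fv /=; apply: leq_trans (dist_min (p := [::]) _ _) _ => //.
case=> [//|[w _]]; rewrite /helps fv; have fw := ltn_ord (f w).
have [fw0|fw0] := eqVneq (nat_of_ord (f w)) 0; first by rewrite /=; lia.
rewrite /= => h; exists w; rewrite lt0n fw0 /=.
case/orP: h => [/andP[vw _]|/andP[/exists_inP[z _ /andP[vz zw]] h5]].
  by apply: leq_trans (dist_min (p := [:: w]) _ _) _ => //=; rewrite ?vw //; lia.
apply: leq_trans (dist_min (p := [:: z; w]) _ _) _ => //=; rewrite ?vz ?zw //; lia.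
Qed.

(** * Edge lists *)

Section EdgeLists.

Variables (V : finType) (G : sgraph V).

(** With [g] constant 1 this computes degrees, with [g] the identity the sums
    of neighbours. *)
Lemma sum_edge_list (es : seq (V * V)) (g : V -> nat) v : edge_list G es ->
  \sum_(e <- es) ((e.1 == v) * g e.2 + (e.2 == v) * g e.1)
  = \sum_(w | adj G v w) g w.
Proof.
case=> es_u esE es_or.
have flat (a b : V * V -> V) (ab : V -> V * V) :
    (forall w, a (ab w) = v) -> (forall w, b (ab w) = w) ->
    (forall e, a e = v -> e = ab (b e)) ->
    \sum_(e <- es) (a e == v) * g (b e) = \sum_w (ab w \in es) * g w.
  move=> a_ab b_ab ab_b; under eq_bigr do rewrite mulnbl.
  under [RHS]eq_bigr do rewrite mulnbl.
  rewrite big_uniq //= -big_mkcondr -[RHS]big_mkcond.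
  rewrite [RHS](reindex_onto b ab) => [|w _]; last by rewrite b_ab.
  apply: eq_bigl => e; apply/andP/andP=> [[ee /eqP/ab_b abe]|[ee /eqP abe]].
    by rewrite -abe.
  by split; rewrite -abe ?a_ab.
rewrite big_split /= (flat fst snd (pair v)) => [|//|//|[a b] /= -> //].
rewrite (flat snd fst (fun w => (w, v))) => [|//|//|[a b] /= -> //].
rewrite -big_split /= [RHS]big_mkcond; apply: eq_bigr => w _.
rewrite esE; case vw: ((v, w) \in es); first by rewrite (negbTE (es_or _ _ vw)) mul1n mul0n addn0.
by rewrite mul0n mulnbl.
Qed.

Lemma connected_setT : connected G -> connected_in G setT.
Proof.
case/andP=> _ /forallP cG a b _ _; rewrite (eq_connect (e' := adj G)).
  by move/forallP: (cG a); apply.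
by move=> x y; rewrite /induced /= !inE.
Qed.

(** The degrees add up to twice the number of edges. *)
Lemma size_edge_list (es : seq (V * V)) :
  is_tree G -> edge_list G es -> size es = #|V|.-1.
Proof.
case=> cG acG esG; have V0 : 0 < #|V| by case/andP: cG.
have := sum_card_nbrs acG (connected_setT cG); rewrite cardsT => /(_ V0).
rewrite (eq_bigl xpredT) => [|v]; last by rewrite inE.
under eq_bigr => v _.
  rewrite (_ : #|nbrs G setT v| = \sum_(e <- es) ((e.1 == v) + (e.2 == v))).
    over.
  have := sum_edge_list (fun=> 1) v esG.
  rewrite sum1dep_card /nbrs => sE; rewrite -[RHS]addn0.
  transitivity (\sum_(e <- es) ((e.1 == v) * 1 + (e.2 == v) * 1)).
    by rewrite sE; apply: eq_card => w; rewrite !inE.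
  by rewrite addn0; apply: eq_bigr => e _; rewrite !muln1.
rewrite exchange_big /=; under eq_bigr => e _.
  rewrite big_split /= -!big_mkcond /= !sum1dep_card.
  rewrite (_ : #|_| = 1); last first.
    by rewrite -(card1 e.1); apply: eq_card => x; rewrite !inE eq_sym.
  rewrite (_ : #|_| = 1); last first.
    by rewrite -(card1 e.2); apply: eq_card => x; rewrite !inE eq_sym.
  over.
rewrite big_const_seq count_predT iter_addn; lia.
Qed.

End EdgeLists.

(** * Tables *)

(** The cost of the levels 1, 3 and 4, which are those of the values 0, 1 and
    2; the other levels do not occur before pruning. *)
Definition leaf_table (K s : nat) : nat :=
  if s == 1 then 0 else if s == 3 then 1 else if s == 4 then 2 else K.

Section Tables.

Variables (V : finType) (G : sgraph V).
Implicit Types (X : {set V}) (A : V -> nat -> nat) (S : V -> nat).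

Definition solves X A S t : Prop :=
  [/\ {in X, forall v, S v < 5}, settled G X S & \sum_(v in X) A v (S v) = t].

(** The invariant for optimality: some labelling is within budget. *)
Definition lower X A C : Prop := exists S t, solves X A S t /\ t <= C.

(** [A'] arises from [A] by pruning [u] into [p]; entries below [K] are
    attained by the pair of levels [cs r] of [p] and [ct r] of [u]. *)
Definition merged (K : nat) X A A' u p (cs ct : nat -> nat) : Prop :=
  [/\ {in X :\ u, forall v s, s < 5 -> v != p -> A' v s = A v s},
      forall s t r, s < 5 -> t < 5 -> absorb s t = Some r ->
        A' p r <= A p s + A u t
    & forall r, r < 5 -> A' p r < K ->
        [/\ cs r < 5, ct r < 5, absorb (cs r) (ct r) = Some r
          & A' p r = A p (cs r) + A u (ct r)]].

Variables (K : nat) (X : {set V}) (A A' : V -> nat -> nat) (u p : V).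
Variables (cs ct : nat -> nat).
Hypotheses (lf : leaf G X u p) (mA : merged K X A A' u p cs ct).

Let sumX (F : V -> nat) :
  \sum_(v in X) F v = F u + (F p + \sum_(v in X :\ u | v != p) F v).
Proof.
have [uX pX _] := lf; rewrite (big_setD1 u) //= (bigD1 p) //=.
by rewrite !inE eq_sym (leaf_neq lf).
Qed.

Let sumX' (F : V -> nat) :
  \sum_(v in X :\ u) F v = F p + \sum_(v in X :\ u | v != p) F v.
Proof.
have [uX pX _] := lf; rewrite (bigD1 p) //=.
by rewrite !inE eq_sym (leaf_neq lf).
Qed.

(** [absorb] cannot fail on a settled labelling, and its value enters the
    merged table at no more than the sum of the two entries. *)
Lemma lower_merged C : lower X A C -> lower (X :\ u) A' C.
Proof.
have [A'E A'le _] := mA; have [uX pX _] := lf.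
case=> S [t [[S5 DS St] tC]].
case mS: (absorb (S p) (S u)) => [m|]; last first.
  by case: (settled_leaf_None lf S5 mS DS).
pose S' v := if v == p then m else S v.
have S'p : S' p = m by rewrite /S' eqxx.
have S'E v : v != p -> S' v = S v by rewrite /S' => /negbTE->.
exists S', (\sum_(v in X :\ u) A' v (S' v)); split.
  split=> // [v|].
    rewrite !inE => /andP[_ vX]; rewrite /S'; case: eqP => _; last exact: S5.
    by apply: absorb_lt5 mS; apply: S5.
  by apply: (settled_leafW lf S5 _ _ DS) => // [v _|]; [apply: S'E | rewrite S'p].
apply: leq_trans tC; rewrite -St sumX sumX' S'p addnA leq_add //.
  by rewrite addnC A'le ?S5.
rewrite leq_eqVlt; apply/orP; left; apply/eqP/eq_bigr => v /andP[vX vp].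
by rewrite A'E // S'E //; apply: S5; move: vX; rewrite inE => /andP[].
Qed.

(** The level of [p] splits into the recorded pair of levels, which attains the
    merged entry because the total is below [K]. *)
Lemma solves_merged S t : t < K -> solves (X :\ u) A' S t ->
  solves X A
    (fun v => if v == u then ct (S p) else if v == p then cs (S p) else S v) t.
Proof.
have [A'E _ A'ch] := mA; have [uX pX _] := lf; have upN := leaf_neq lf.
have pX' : p \in X :\ u by rewrite !inE eq_sym upN.
move=> tK [S5 DS St]; set S' := fun v => _.
have S'u : S' u = ct (S p) by rewrite /S' eqxx.
have S'p : S' p = cs (S p) by rewrite /S' eq_sym (negbTE upN) eqxx.
have S'E v : v \in X :\ u -> v != p -> S' v = S v.
  by rewrite !inE /S' => /andP[/negbTE-> _] /negbTE->.
have Sp : A' p (S p) < K.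
  by apply: leq_ltn_trans tK; rewrite -St sumX' leq_addr.
have [cs5 ct5 mS A'p] := A'ch _ (S5 p pX') Sp.
have S'5 : {in X, forall v, S' v < 5}.
  move=> v vX; have [->|vu] := eqVneq v u; first by rewrite S'u.
  have [->|vp] := eqVneq v p; first by rewrite S'p.
  by rewrite S'E ?S5 // !inE vu.
split=> //; last first.
  rewrite -St sumX sumX' S'u S'p A'p addnA (addnC (A u _)); congr (_ + _).
  by apply: eq_bigr => v /andP[vX vp]; rewrite S'E // A'E ?S5.
apply: (settled_leafV lf S'5 _ _ DS) => // [v vX vp|]; first by rewrite S'E.
by rewrite S'u S'p.
Qed.

End Tables.

(** The last vertex must hear a broadcast, so its level is 2, 3 or 4. *)
Lemma lower_root (V : finType) (G : sgraph V) (A : V -> nat -> nat) r C :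
  lower G [set r] A C ->
  minn (A r 2) (minn (A r 3) (A r 4)) <= C.
Proof.
case=> S [t [[S5 DS St] tC]]; apply: leq_trans tC; rewrite -St big_set1.
have Sr := S5 r (set11 r); move/settled1: DS => /(_ Sr).
by case: (S r) Sr => [|[|[|[|[|]]]]] //= _ _; lia.
Qed.

Section Optimum.

Variables (V : finType) (G : sgraph V) (A : V -> nat -> nat).
Hypothesis (cG : connected G).

Lemma lower_init K (AE : forall v s, s < 5 -> A v s = leaf_table K s) :
  lower G setT A (gammaB2 G).
Proof.
have [[f domf costf] _] := gammaB2P G.
have lev v : level0 (f v) < 5 by have := ltn_ord (f v); rewrite /level0; case: eqP; lia.
exists (fun v => level0 (f v)), (gammaB2 G); split=> //; split=> [v _||].
- exact: lev.
- exact/dominatingP.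
rewrite -costf; apply: eq_big => [v|v _]; first by rewrite inE.
by rewrite AE //; case: (f v) => -[|[|[|]]].
Qed.

(** Entries below [K] occur for the levels 1, 3 and 4 only, and truncated
    subtraction sends these to the broadcast values 0, 1 and 2. *)
Lemma solves_init K S t (AE : forall v s, s < 5 -> A v s = leaf_table K s) :
  t < K -> solves G setT A S t ->
  let f := [ffun v => inord (S v - 2) : 'I_3] in
  [/\ dominating G f, cost f = t & forall v, nat_of_ord (f v) = S v - 2].
Proof.
move=> tK [S5 DS St] f.
have Sv v : leaf_table K (S v) < K.
  apply: leq_ltn_trans tK; rewrite -St (bigD1 v) ?inE //= AE ?S5 ?inE //.
  exact: leq_addr.
have S3 v : S v - 2 < 3 by have := S5 v (in_setT v); lia.
have fE v : nat_of_ord (f v) = S v - 2 by rewrite ffunE inordK.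
have SE v : level0 (f v) = S v /\ leaf_table K (S v) = f v.
  rewrite fE; have := Sv v; rewrite /leaf_table /level0.
  by move: (S5 v (in_setT v)); case: (S v) => [|[|[|[|[|]]]]] //=; rewrite ?ltnn.
split=> //.
  apply/dominatingP => // v vT; case: (DS v vT) => [|[w wT h]]; rewrite ?(proj1 (SE _)).
    by left.
  by right; exists w => //; rewrite /helps !(proj1 (SE _)).
rewrite -St; apply: eq_big => [v|v _]; first by rewrite inE.
by rewrite AE ?S5 ?inE // (proj2 (SE _)).
Qed.

End Optimum.

(** * Reasoning about programs *)

(** State updates are locked: otherwise unification unfolds nested updates,
    and their size is exponential in the nesting depth. *)
Fact state_key : unit. Proof. exact: tt. Qed.

Definition write_reg (s : state) r x :=
  locked_with state_key (State [eta regs s with r |-> x] (heap s)).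
Definition write_heap (s : state) a x :=
  locked_with state_key (State (regs s) [eta heap s with a |-> x]).

Lemma regs_write_reg s r x r' : regs (write_reg s r x) r' = if r' == r then x else regs s r'.
Proof. by rewrite /write_reg unlock. Qed.
Lemma heap_write_reg s r x : heap (write_reg s r x) = heap s.
Proof. by rewrite /write_reg unlock. Qed.
Lemma regs_write_heap s a x : regs (write_heap s a x) = regs s.
Proof. by rewrite /write_heap unlock. Qed.
Lemma heap_write_heap s a x b : heap (write_heap s a x) b = if b == a then x else heap s b.
Proof. by rewrite /write_heap unlock. Qed.

Lemma write_reg_same s r x y : write_reg (write_reg s r x) r y = write_reg s r y.
Proof.
rewrite /write_reg !unlock; congr State; apply: functional_extensionality => z /=.
by case: eqP.
Qed.

Lemma write_reg_comm s r1 r2 x1 x2 : r1 != r2 ->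
  write_reg (write_reg s r1 x1) r2 x2 = write_reg (write_reg s r2 x2) r1 x1.
Proof.
move=> r12; rewrite /write_reg !unlock; congr State; apply: functional_extensionality => z /=.
by case: (z =P r2) => // ->; rewrite eq_sym (negbTE r12).
Qed.

Definition writeE := (regs_write_reg, heap_write_reg, regs_write_heap, heap_write_heap).

(** Total correctness with the running time left out. *)
Definition halts W p s (Q : state -> Prop) :=
  exists t s', exec W p s t s' /\ Q s'.

Lemma set_reg_le W s r x : x <= W -> set_reg W s r x = Some (write_reg s r x).
Proof. by rewrite /set_reg /write_reg unlock => ->. Qed.

Lemma step_store W s a b : step W (IStore a b) s = Some (write_heap s (regs s a) (regs s b)).
Proof. by rewrite /write_heap unlock. Qed.

Section Logic.
Variable W : nat.
Implicit Types (p q : cmd) (s : state) (Q R : state -> Prop).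

Lemma halts_weaken p s Q R : halts W p s R -> (forall s', R s' -> Q s') -> halts W p s Q.
Proof. by case=> t [s' [e r]] RQ; exists t, s'; split=> //; apply: RQ. Qed.

Lemma halts_skip s Q : Q s -> halts W CSkip s Q.
Proof. by exists 0, s; split=> //; apply: ExecSkip. Qed.

Lemma halts_seq p q s Q :
  halts W p s (fun s' => halts W q s' Q) -> halts W (CSeq p q) s Q.
Proof.
case=> t1 [s1 [e1 [t2 [s2 [e2 r]]]]]; exists (t1 + t2), s2; split=> //.
exact: ExecSeq e1 e2.
Qed.

Lemma halts_instr i s s' Q : step W i s = Some s' -> Q s' -> halts W (CInstr i) s Q.
Proof. by move=> e r; exists 1, s'; split=> //; apply: ExecInstr. Qed.

Lemma halts_const r c s Q : c <= W -> Q (write_reg s r c) -> halts W (CInstr (IConst r c)) s Q.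
Proof. by move=> h; apply: halts_instr; apply: set_reg_le. Qed.
Lemma halts_move r a s Q : regs s a <= W ->
  Q (write_reg s r (regs s a)) -> halts W (CInstr (IMove r a)) s Q.
Proof. by move=> h; apply: halts_instr; apply: set_reg_le. Qed.
Lemma halts_add r a b s Q : regs s a + regs s b <= W ->
  Q (write_reg s r (regs s a + regs s b)) -> halts W (CInstr (IAdd r a b)) s Q.
Proof. by move=> h; apply: halts_instr; apply: set_reg_le. Qed.
Lemma halts_sub r a b s Q : regs s a - regs s b <= W ->
  Q (write_reg s r (regs s a - regs s b)) -> halts W (CInstr (ISub r a b)) s Q.
Proof. by move=> h; apply: halts_instr; apply: set_reg_le. Qed.
Lemma halts_load r a s Q : heap s (regs s a) <= W ->
  Q (write_reg s r (heap s (regs s a))) -> halts W (CInstr (ILoad r a)) s Q.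
Proof. by move=> h; apply: halts_instr; apply: set_reg_le. Qed.
Lemma halts_store a b s Q :
  Q (write_heap s (regs s a) (regs s b)) -> halts W (CInstr (IStore a b)) s Q.
Proof. by move=> Qs; apply: halts_instr Qs; apply: step_store. Qed.

Lemma halts_if r p q s Q :
  (regs s r != 0 -> halts W p s Q) -> (regs s r = 0 -> halts W q s Q) ->
  halts W (CIf r p q) s Q.
Proof.
have [r0 _ /(_ r0)|r0 /(_ isT) + _] := eqVneq (regs s r) 0.
  by case=> t [s' [e Qs]]; exists t.+1, s'; split=> //; apply: ExecIfFalse.
by case=> t [s' [e Qs]]; exists t.+1, s'; split=> //; apply: ExecIfTrue.
Qed.

End Logic.

Fixpoint loopfree p :=
  match p with
  | CSkip | CInstr _ => true
  | CSeq p q | CIf _ p q => loopfree p && loopfree q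
  | CWhile _ _ => false
  end.

(** A bound for programs without loops; the value for [CWhile] is a dummy. *)
Fixpoint max_steps p :=
  match p with
  | CSkip => 0
  | CInstr _ => 1
  | CSeq p q => max_steps p + max_steps q
  | CIf _ p q => (maxn (max_steps p) (max_steps q)).+1
  | CWhile _ _ => 0
  end.

Lemma exec_max_steps W p s t s' : exec W p s t s' -> loopfree p -> t <= max_steps p.
Proof.
elim=> //= [{}p q s1 s2 s3 t1 t2 _ IHp _ IHq /andP[/IHp + /IHq]||]; first lia.
- by move=> r {}p q s1 s2 t1 _ _ IH /andP[/IH + _]; lia.
- by move=> r {}p q s1 s2 t1 _ _ IH /andP[_ /IH]; lia.
Qed.

Definition runs W p s T (Q : state -> Prop) :=
  exists t s', [/\ exec W p s t s', t <= T & Q s'].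

Section Timed.
Variable W : nat.

Lemma runs_halts p s Q : loopfree p -> halts W p s Q -> runs W p s (max_steps p) Q.
Proof. by move=> lp [t [s' [e q]]]; exists t, s'; split=> //; apply: exec_max_steps e lp. Qed.

Lemma runs_seq p q s T1 T2 (Q : state -> Prop) :
  runs W p s T1 (fun s' => runs W q s' T2 Q) -> runs W (CSeq p q) s (T1 + T2) Q.
Proof.
case=> t1 [s1 [e1 le1 [t2 [s2 [e2 le2 qs]]]]].
exists (t1 + t2), s2; split=> //; first exact: ExecSeq e1 e2.
exact: leq_add.
Qed.

(** The loop register is a countdown, and the invariant is indexed by the number
    of rounds that remain. *)
Lemma runs_while r p (I : nat -> state -> Prop) k s :
  loopfree p -> I k s ->
  (forall k s, I k s -> regs s r = k) ->
  (forall k s, I k.+1 s -> halts W p s (I k)) ->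
  runs W (CWhile r p) s ((max_steps p).+1 * k).+1 (I 0).
Proof.
move=> lp Is Ir Ip; elim: k s Is => [|k IH] s Is.
  by exists 1, s; split; rewrite ?muln0 //; apply: ExecWhileFalse; apply: Ir Is.
have [t1 [s1 [e1 le1 /IH[t2 [s2 [e2 le2 I0]]]]]] := runs_halts lp (Ip k s Is).
exists (t1 + t2).+1, s2; split=> //.
  by apply: ExecWhileTrue e1 e2; rewrite (Ir _ _ Is).
by rewrite mulnS; clear -le1 le2; lia.
Qed.

End Timed.

(** * The programs *)

(** Registers: the order [rN] of the tree, the base [rB] of the records, a value
    [rInf] above all costs, the constant 1 in [rOne], a loop countdown [rK], a loop index
    [rI], the vertex [rU] and its neighbour [rP], and the length [rT] of the
    queue. Registers from 10 on are scratch. *)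
Notation rN := 0 (only parsing).
Notation rB := 1 (only parsing).
Notation rInf := 2 (only parsing).
Notation rOne := 3 (only parsing).
Notation rK := 4 (only parsing).
Notation rI := 5 (only parsing).
Notation rU := 6 (only parsing).
Notation rP := 7 (only parsing).
Notation rT := 8 (only parsing).
Notation rA := 10 (only parsing).
Notation rF := 11 (only parsing).
Notation rX := 12 (only parsing).
Notation rY := 13 (only parsing).
Notation rZ := 14 (only parsing).

(** Each vertex has a record of 32 cells, of which these are fields: its
    degree, the sum of its neighbours, its final level, its table ([fTab],
    fields 4 to 8), and, once it is pruned, the merged table ([fNew]) and the
    levels of the neighbour ([fOwn]) and of the vertex itself ([fSub]) that
    attain each merged entry (fields 9 to 23). Field [fQueue] of record [i] is
    entry [i] of the queue, which has nothing to do with vertex [i]. *)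
Notation fDeg := 0 (only parsing).
Notation fNbr := 1 (only parsing).
Notation fQueue := 2 (only parsing).
Notation fSol := 3 (only parsing).
Notation fTab := 4 (only parsing).
Notation fNew := 9 (only parsing).
Notation fOwn := 14 (only parsing).
Notation fSub := 19 (only parsing).

Lemma main_neq_scratch x y : x < 10 -> 10 <= y -> (x == y) = false.
Proof. by clear; lia. Qed.

Definition block := foldr CSeq CSkip.

(** The input occupies [2 * n - 1] cells, so the records start at [2 * n]. *)
Definition cell n v c := n.*2 + (32 * v + c).

Lemma cell_eq n v c v' c' : c < 32 -> c' < 32 ->
  (cell n v c == cell n v' c') = (v == v') && (c == c').
Proof. by rewrite /cell => c32 c32'; lia. Qed.

Lemma input_neq_cell n a v c : a < n.*2 -> (a == cell n v c) = false.
Proof. by rewrite /cell; lia. Qed.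

(** The machine has no multiplication: the factor 32 is five doublings. *)
Definition addr_code v c := block (map CInstr
  [:: IAdd rA v v; IAdd rA rA rA; IAdd rA rA rA; IAdd rA rA rA; IAdd rA rA rA;
      IAdd rA rA rB; IConst rF c; IAdd rA rA rF]).

Definition load_code r v c := CSeq (addr_code v c) (CInstr (ILoad r rA)).
Definition store_code v c a := CSeq (addr_code v c) (CInstr (IStore rA a)).

Notation addressed s c a := (write_reg (write_reg s rF c) rA a).

Definition loadx_code r v c x :=
  CSeq (addr_code v c) (CSeq (CInstr (IAdd rA rA x)) (CInstr (ILoad r rA))).

Definition inc r := CInstr (IAdd r r rOne).
Definition dec r := CInstr (ISub r r rOne).

Definition bump u p := block
  [:: load_code rX u fDeg; inc rX; store_code u fDeg rX;
      load_code rX u fNbr; CInstr (IAdd rX rX p); store_code u fNbr rX].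

Definition setup := block
  [:: CInstr (ILoad rN rN); CInstr (IAdd rB rN rN); CInstr (IConst rOne 1);
      CInstr (IAdd rInf rB rOne); CInstr (ISub rK rN rOne); CInstr (IConst rI 1)].

Definition edge_body := block
  [:: CInstr (ILoad rU rI); inc rI; CInstr (ILoad rP rI); inc rI;
      bump rU rP; bump rP rU; dec rK].

(** Degree 1 is recognised by [d <> 0] and [d - 1 = 0]; a vertex of degree 0
    is not pushed. *)
Definition push_code v := block
  [:: load_code rX v fDeg;
      CIf rX (block [:: dec rX;
        CIf rX CSkip (block [:: store_code rT fQueue v; inc rT])]) CSkip].

Definition table_setup := block
  [:: CInstr (IMove rK rN); CInstr (IConst rI 0); CInstr (IConst rT 0)].

Definition leaf_table_code := block
  [:: store_code rI (fTab + 0) rInf;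
      CInstr (IConst rX 0); store_code rI (fTab + 1) rX;
      store_code rI (fTab + 2) rInf;
      store_code rI (fTab + 3) rOne;
      CInstr (IConst rX 2); store_code rI (fTab + 4) rX].

Definition table_body := block
  [:: leaf_table_code; push_code rI; inc rI; dec rK].

Definition new_code r := store_code rU (fNew + r) rInf.

(** Offers level [s] of [rP] together with level [t] of [rU] as a way to reach
    the merged level [r]. *)
Definition relax_code (e : nat * nat * nat) :=
  let: (s, t, r) := e in block
  [:: load_code rX rP (fTab + s); load_code rY rU (fTab + t);
      CInstr (IAdd rX rX rY); load_code rY rU (fNew + r);
      CInstr (ISub rY rY rX);
      CIf rY (block
        [:: store_code rU (fNew + r) rX;
            CInstr (IConst rX s); store_code rU (fOwn + r) rX;
            CInstr (IConst rX t); store_code rU (fSub + r) rX]) CSkip].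

Definition copy_code r := block
  [:: load_code rX rU (fNew + r); store_code rP (fTab + r) rX].

(** The graph of [absorb], over which the merging code is unrolled. *)
Definition absorb_table : seq (nat * nat * nat) :=
  pmap (fun e => omap (pair e) (absorb e.1 e.2))
    [seq (s, t) | s <- iota 0 5, t <- iota 0 5].

Definition merge_code := block
  [:: block (map new_code (iota 0 5)); block (map relax_code absorb_table);
      block (map copy_code (iota 0 5))].

Definition prune_setup := block
  [:: CInstr (ISub rK rN rOne); CInstr (IConst rI 0); CInstr (IConst rP 0)].

Definition unlink_code := block
  [:: load_code rX rP fDeg; dec rX; store_code rP fDeg rX;
      load_code rX rP fNbr; CInstr (ISub rX rX rU); store_code rP fNbr rX].

Definition prune_body := block
  [:: load_code rU rI fQueue; load_code rP rU fNbr; unlink_code;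
      push_code rP; merge_code; inc rI; dec rK].

Definition choose_code s := block
  [:: load_code rY rP (fTab + s); CInstr (ISub rA rX rY);
      CIf rA (block [:: CInstr (IMove rX rY); CInstr (IConst rZ s)]) CSkip].

(** Leaves the least of the entries 2, 3 and 4 in [rX] and its level in the
    record of the last vertex. *)
Definition select_code := block
  [:: load_code rX rP (fTab + 2); CInstr (IConst rZ 2);
      choose_code 3; choose_code 4; store_code rP fSol rZ].

Definition back_setup := block [:: CInstr (ISub rK rN rOne)].

Definition back_body := block
  [:: dec rK; load_code rU rK fQueue; load_code rP rU fNbr;
      load_code rX rP fSol; loadx_code rY rU fOwn rX; loadx_code rZ rU fSub rX;
      store_code rP fSol rY; store_code rU fSol rZ].

Definition out_setup := block [:: CInstr (IMove rK rN); CInstr (IConst rI 0)].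

Definition out_body := block
  [:: load_code rX rI fSol; CInstr (IConst rY 2); CInstr (ISub rX rX rY);
      CInstr (IStore rI rX); inc rI; dec rK].

(** * Specification of the loop-free blocks *)

Section Records.
Variables n W : nat.
Hypotheses (n0 : 0 < n) (hW : 64 * n.+1 ^ 2 <= W).

Lemma big_word : 64 * n.+1 <= W /\ 64 + 4 * (n * n) <= W.
Proof. by move: hW; rewrite expnS expn1; nia. Qed.

Lemma cell_le v c : v < n -> c < 32 -> cell n v c <= W.
Proof. by case: big_word; rewrite /cell; clear; lia. Qed.

(** The intermediate values of the address register are overwritten, so the
    final state is a plain double update. *)
Lemma halts_addr v c s (Q : state -> Prop) :
  regs s rB = n.*2 -> regs s v < n -> c < 32 ->
  Q (addressed s c (cell n (regs s v) c)) -> halts W (addr_code v c) s Q.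
Proof.
move=> sB vn c32 Qs; have := cell_le vn c32; rewrite /cell => hc.
rewrite /addr_code /=.
apply/halts_seq/halts_add; first by clear -hc; lia.
do 4!(apply/halts_seq/halts_add; rewrite !writeE /=; first by clear -hc; lia).
apply/halts_seq/halts_add; rewrite !writeE /= ?sB; first by clear -hc; lia.
apply/halts_seq/halts_const; first by clear -hc; lia.
apply/halts_seq/halts_add; rewrite !writeE /=; first by clear -hc; lia.
apply: halts_skip; congr Q: Qs.
rewrite !write_reg_same [RHS](@write_reg_comm _ rF rA) // write_reg_same.
rewrite [LHS](@write_reg_comm _ rF rA) //.
congr write_reg; congr write_reg; rewrite /cell; clear; lia.
Qed.

Lemma seq_load r v c q s (Q : state -> Prop) :
  regs s rB = n.*2 -> regs s v < n -> c < 32 ->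
  heap s (cell n (regs s v) c) <= W ->
  halts W q (write_reg (addressed s c (cell n (regs s v) c)) r
                (heap s (cell n (regs s v) c))) Q ->
  halts W (CSeq (load_code r v c) q) s Q.
Proof.
move=> sB vn c32 hW' Qs; apply/halts_seq/halts_seq/halts_addr => //.
by apply: halts_load; rewrite !writeE eqxx.
Qed.

Lemma seq_store v c a q s (Q : state -> Prop) :
  regs s rB = n.*2 -> regs s v < n -> c < 32 -> a != rA -> a != rF ->
  halts W q (write_heap (addressed s c (cell n (regs s v) c))
                (cell n (regs s v) c) (regs s a)) Q ->
  halts W (CSeq (store_code v c a) q) s Q.
Proof.
move=> sB vn c32 aA aF Qs; apply/halts_seq/halts_seq/halts_addr => //.
by apply: halts_store; move: Qs; rewrite !writeE eqxx (negbTE aA) (negbTE aF).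
Qed.

Lemma seq_loadx r v c x q s (Q : state -> Prop) :
  regs s rB = n.*2 -> regs s v < n -> x != rA -> x != rF ->
  c + regs s x < 32 -> heap s (cell n (regs s v) (c + regs s x)) <= W ->
  (forall a b, halts W q (write_reg (addressed s a b) r
                (heap s (cell n (regs s v) (c + regs s x)))) Q) ->
  halts W (CSeq (loadx_code r v c x) q) s Q.
Proof.
move=> sB vn xA xF c32 hW' Qs; apply/halts_seq/halts_seq/halts_addr => //.
  by apply: leq_ltn_trans c32; apply: leq_addr.
have cE : cell n (regs s v) c + regs s x = cell n (regs s v) (c + regs s x).
  by rewrite /cell; clear; lia.
apply/halts_seq/halts_add; rewrite !writeE (negbTE xA) (negbTE xF) /= cE.
  exact: cell_le.
by apply: halts_load; rewrite !writeE /= ?write_reg_same.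
Qed.

Definition fld s v c := heap s (cell n v c).

(** Only scratch registers may differ. *)
Definition frame s s' := forall x, x < 10 -> regs s' x = regs s x.

(** Addresses below [2 * n] hold the edges, and later the output. *)
Definition keeps s s' := forall a, a < n.*2 -> heap s' a = heap s a.

Lemma bump_spec u p s : u < 10 -> p < 10 ->
  regs s rB = n.*2 -> regs s rOne = 1 -> regs s u < n -> regs s p < n ->
  fld s (regs s u) fDeg + 1 <= W -> fld s (regs s u) fNbr + regs s p <= W ->
  halts W (bump u p) s (fun s' => [/\ frame s s', keeps s s' &
    forall v c, c < 32 -> fld s' v c =
      fld s v c + (v == regs s u) * ((c == 0) + (c == 1) * regs s p)]).
Proof.
rewrite /fld => u10 p10 sB s1 un pn d1 e1.
have [uA uF uX] : [/\ (u == rA) = false, (u == rF) = false & (u == rX) = false].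
  by split; apply: main_neq_scratch.
have [pA pF pX] : [/\ (p == rA) = false, (p == rF) = false & (p == rX) = false].
  by split; apply: main_neq_scratch.
have E := (writeE, uA, uF, uX, pA, pF, pX).
rewrite /bump /=; apply: seq_load => //; first by clear -d1; lia.
apply/halts_seq/halts_add; rewrite !E /= s1 //.
apply: seq_store; rewrite ?E //.
apply: seq_load; rewrite ?E ?cell_eq //= ?andbF //; first by clear -e1; lia.
apply/halts_seq/halts_add; rewrite !E ?cell_eq //= ?andbF //.
apply: seq_store; rewrite ?E //.
apply: halts_skip; split.
- by move=> x x10; rewrite !writeE !main_neq_scratch.
- by move=> a an; rewrite !writeE !input_neq_cell.
move=> v c c32; rewrite !writeE !cell_eq //=.
have [-> /=|_ /=] := eqVneq v (regs s u); last by rewrite mul0n addn0.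
by case: c c32 => [|[|c]] c32 /=; rewrite ?E /= ?cell_eq //= ?andbF; clear; lia.
Qed.

End Records.

Section Blocks.
Variables n W : nat.
Hypotheses (n0 : 0 < n) (hW : 64 * n.+1 ^ 2 <= W).

Lemma push_spec v s : v < 10 -> v != rT ->
  regs s rB = n.*2 -> regs s rOne = 1 -> regs s v < n ->
  fld n s (regs s v) fDeg <= n ->
  (fld n s (regs s v) fDeg = 1 -> regs s rT < n) ->
  halts W (push_code v) s (fun s' =>
    let b := fld n s (regs s v) fDeg == 1 in
    [/\ forall x, x < 10 -> x != rT -> regs s' x = regs s x,
        regs s' rT = regs s rT + b, keeps n s s'
      & forall w c, c < 32 -> fld n s' w c =
          if [&& b, w == regs s rT & c == 2] then regs s v else fld n s w c]).
Proof.
have [W1 W2] := big_word n0 hW.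
rewrite /fld => v10 vT sB s1 vn d1 tn.
have [vA vF vX] : [/\ (v == rA) = false, (v == rF) = false & (v == rX) = false].
  by split; apply: main_neq_scratch.
have E := (writeE, vA, vF, vX).
rewrite /push_code /=; apply: (seq_load n0 hW) => //; first by clear -d1 W1; lia.
have nW : n <= W by clear -W1; lia.
apply/halts_seq/halts_if; rewrite !writeE /= => d0.
  apply/halts_seq/halts_sub; rewrite !writeE /= s1; first by clear -d1 nW; lia.
  apply/halts_seq/halts_if; rewrite !writeE /= => d2.
    do 3!apply: halts_skip.
    rewrite (_ : (_ == 1) = false); last by clear -d2; lia.
    split=> [x x10 _||a an|w c c32]; rewrite ?writeE /= ?addn0 //.
    by rewrite !main_neq_scratch.
  have {}d1 : heap s (cell n (regs s v) 0) = 1 by clear -d0 d2; lia.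
  have {}tn := tn d1; rewrite d1 eqxx /=.
  apply: (seq_store n0 hW); rewrite ?E //.
  apply/halts_seq/halts_add; rewrite !writeE /= ?s1; first by clear -tn nW; lia.
  do 3!apply: halts_skip; split=> [x x10 xT||a an|w c c32]; rewrite !E //=.
  - by rewrite (negbTE xT) !main_neq_scratch.
  - by rewrite input_neq_cell.
  - by rewrite cell_eq.
do 2!apply: halts_skip; rewrite d0 /=.
split=> [x x10 _||a an|w c c32]; rewrite ?writeE /= ?addn0 //.
by rewrite !main_neq_scratch.
Qed.

Lemma unlink_spec s :
  regs s rB = n.*2 -> regs s rOne = 1 -> regs s rU < n -> regs s rP < n ->
  fld n s (regs s rP) fDeg <= W -> fld n s (regs s rP) fNbr <= W ->
  halts W unlink_code s (fun s' => [/\ frame s s', keeps n s s' &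
    forall v c, c < 32 -> fld n s' v c =
      fld n s v c - (v == regs s rP) * ((c == 0) + (c == 1) * regs s rU)]).
Proof.
rewrite /fld => sB s1 un pn d1 e1.
rewrite /unlink_code /=; apply: (seq_load n0 hW) => //.
apply/halts_seq/halts_sub; rewrite !writeE /= s1; first by clear -d1; lia.
apply: (seq_store n0 hW); rewrite ?writeE //.
apply: (seq_load n0 hW); rewrite ?writeE ?cell_eq //= ?andbF //.
apply/halts_seq/halts_sub; rewrite !writeE ?cell_eq //= ?andbF //; first by clear -e1; lia.
apply: (seq_store n0 hW); rewrite ?writeE //.
apply: halts_skip; split.
- by move=> x x10; rewrite !writeE !main_neq_scratch.
- by move=> a an; rewrite !writeE !input_neq_cell.
move=> v c c32; rewrite !writeE !cell_eq //=.
have [-> /=|_ /=] := eqVneq v (regs s rP); last by rewrite mul0n subn0.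
by case: c c32 => [|[|c]] c32 /=; rewrite ?mul0n ?mul1n ?subn0 ?addn0 ?add0n.
Qed.

Lemma leaf_table_spec s :
  regs s rB = n.*2 -> regs s rOne = 1 -> regs s rInf = n.*2.+1 -> regs s rI < n ->
  halts W leaf_table_code s (fun s' => [/\ frame s s', keeps n s s',
    forall t, t < 5 -> fld n s' (regs s rI) (fTab + t) = leaf_table n.*2.+1 t &
    forall v c, c < 32 -> ~~ [&& v == regs s rI, 4 <= c & c < 9] ->
      fld n s' v c = fld n s v c]).
Proof.
have [W1 W2] := big_word n0 hW; have W2' : 2 <= W by clear -W2; lia.
rewrite /fld => sB s1 sI vn.
rewrite /leaf_table_code /=.
apply: (seq_store n0 hW); rewrite ?writeE //.
apply/halts_seq/halts_const => //.
apply: (seq_store n0 hW); rewrite ?writeE //.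
apply: (seq_store n0 hW); rewrite ?writeE //.
apply: (seq_store n0 hW); rewrite ?writeE //.
apply/halts_seq/halts_const => //.
apply: (seq_store n0 hW); rewrite ?writeE //.
apply: halts_skip; split.
- by move=> x x10; rewrite !writeE !main_neq_scratch.
- by move=> a an; rewrite !writeE !input_neq_cell.
- move=> t t5; rewrite !writeE !cell_eq; try by clear -t5; lia.
  by case: t t5 => [|[|[|[|[|]]]]] //= _; rewrite eqxx /= ?writeE ?s1.
move=> v c c32 h; rewrite !writeE !cell_eq //=.
by rewrite !ifF //; clear -h; lia.
Qed.

End Blocks.

Lemma absorb_tableP a t r :
  reflect [/\ a < 5, t < 5 & absorb a t = Some r] ((a, t, r) \in absorb_table).
Proof.
rewrite mem_pmap; apply: (iffP mapP) => [[[a' t'] /allpairsP[[x y] []]]|[a5 t5 atr]].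
  rewrite !mem_iota => x5 y5 [-> ->] /=.
  by case xyr: (absorb x y) => [m|] //= [-> -> ->].
exists (a, t); last by rewrite /= atr.
by apply/allpairsP; exists (a, t); rewrite !mem_iota.
Qed.

(** The invariant is indexed by the list of items that have been treated. *)
Lemma halts_block_map W (T : eqType) (code : T -> cmd) (I : seq T -> state -> Prop) l s :
  I [::] s ->
  (forall l1 e s, e \in l -> I l1 s -> halts W (code e) s (I (rcons l1 e))) ->
  halts W (block (map code l)) s (I l).
Proof.
move=> Is step.
suff all_steps l2 l1 s' : {subset l2 <= l} -> I l1 s' ->
    halts W (block (map code l2)) s' (I (l1 ++ l2)) by apply: (all_steps l [::]).
elim: l2 l1 s' => [|e l2 IH] l1 s' sub Is' /=; first by rewrite cats0; apply: halts_skip.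
have el := sub e (mem_head _ _).
apply/halts_seq/(halts_weaken (step _ _ _ el Is')) => s2 Is2.
by rewrite -cat_rcons; apply: IH => // x xl; apply: sub; rewrite inE xl orbT.
Qed.

Section Relaxation.
Variables n W : nat.
Hypotheses (n0 : 0 < n) (hW : 64 * n.+1 ^ 2 <= W).

Lemma new_spec s : regs s rB = n.*2 -> regs s rU < n -> regs s rInf = n.*2.+1 ->
  halts W (block (map new_code (iota 0 5))) s (fun s' => [/\ frame s s', keeps n s s',
    forall r, r < 5 -> fld n s' (regs s rU) (fNew + r) = n.*2.+1 &
    forall v c, c < 32 -> ~~ [&& v == regs s rU, 9 <= c & c < 24] ->
      fld n s' v c = fld n s v c]).
Proof.
rewrite /fld => sB un sI /=.
do 5!(apply: (seq_store n0 hW); rewrite ?writeE //).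
apply: halts_skip; split.
- by move=> x x10; rewrite !writeE !main_neq_scratch.
- by move=> a an; rewrite !writeE !input_neq_cell.
- move=> t t5; rewrite !writeE !cell_eq; try by clear -t5; lia.
  by case: t t5 => [|[|[|[|[|]]]]] //= _; rewrite eqxx /= ?writeE ?s1.
move=> v c c32 h; rewrite !writeE !cell_eq //=.
by rewrite !ifF //; clear -h; lia.
Qed.

(** Invariant of the unrolled merging code: [s0] is the state before it, and [l]
    are the triples treated so far. *)
Definition relaxed s0 (l : seq (nat * nat * nat)) s : Prop :=
  let u := regs s0 rU in let p := regs s0 rP in
  [/\ frame s0 s, keeps n s0 s,
      forall v c, c < 32 -> ~~ [&& v == u, 9 <= c & c < 24] ->
        fld n s v c = fld n s0 v c,
      forall r, r < 5 -> fld n s u (fNew + r) <= n.*2.+1 /\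
        (fld n s u (fNew + r) < n.*2.+1 ->
         (fld n s u (fOwn + r), fld n s u (fSub + r), r) \in absorb_table /\
         fld n s u (fNew + r) = fld n s0 p (fTab + fld n s u (fOwn + r))
                           + fld n s0 u (fTab + fld n s u (fSub + r)))
    & forall a t r, r < 5 -> (a, t, r) \in l ->
        fld n s u (fNew + r) <= fld n s0 p (fTab + a) + fld n s0 u (fTab + t)].

Lemma relax_spec s0 l s a t r :
  regs s0 rB = n.*2 -> regs s0 rU < n -> regs s0 rP < n -> regs s0 rU != regs s0 rP ->
  (forall b, b < 5 -> fld n s0 (regs s0 rP) (fTab + b) <= n.*2.+1) ->
  (forall b, b < 5 -> fld n s0 (regs s0 rU) (fTab + b) <= n.*2.+1) ->
  (a, t, r) \in absorb_table -> relaxed s0 l s ->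
  halts W (relax_code (a, t, r)) s (relaxed s0 (rcons l (a, t, r))).
Proof.
have [W1 W2] := big_word n0 hW; have nW : (n.*2.+1).*2 <= W by clear -W1; lia.
have W5 : 5 <= W by clear -W2; lia.
move=> sB un pn up pK uK atr [fr kp old new cand].
have /absorb_tableP[a5 t5 /(absorb_lt5 a5 t5) r5] := atr.
have [a32 t32 r9 r14 r19] : [/\ 4 + a < 32, 4 + t < 32, 9 + r < 32, 14 + r < 32 & 19 + r < 32].
  by clear -a5 t5 r5; split; lia.
have sB' : regs s rB = n.*2 by rewrite fr.
have sU : regs s rU = regs s0 rU by rewrite fr.
have sP : regs s rP = regs s0 rP by rewrite fr.
have pa : heap s (cell n (regs s0 rP) (4 + a)) = fld n s0 (regs s0 rP) (fTab + a).
  by apply: old => //; rewrite eq_sym (negbTE up).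
have ut : heap s (cell n (regs s0 rU) (4 + t)) = fld n s0 (regs s0 rU) (fTab + t).
  by apply: old => //; clear -t5; lia.
have [{}pK {}uK] := (pK a a5, uK t t5).
have [wK _] := new r r5.
set u := regs s0 rU in un up uK ut old new cand sU wK *.
set p := regs s0 rP in pn up pK pa old new cand sP *.
set z := fld n s0 p (fTab + a) + fld n s0 u (fTab + t).
have zW : z <= W by rewrite /z; clear -pK uK nW; lia.
have wW : fld n s u (fNew + r) <= W by clear -wK nW; lia.
rewrite /relax_code /=.
apply: (seq_load n0 hW); rewrite ?sU ?sP ?pa //; first by clear -pK nW; lia.
apply: (seq_load n0 hW); rewrite ?writeE /= ?sU ?sP ?ut //; first by clear -uK nW; lia.
apply/halts_seq/halts_add; rewrite !writeE /= -/z //.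
apply: (seq_load n0 hW); rewrite ?writeE /= ?sU ?sP //.
apply/halts_seq/halts_sub; rewrite !writeE /= -/(fld n s u (fNew + r)).
  by clear -wW; lia.
apply/halts_seq/halts_if; rewrite !writeE /= => zw; last first.
  do 2!apply: halts_skip; split.
  - by move=> x x10; rewrite !writeE !main_neq_scratch // fr.
  - by move=> b bn; rewrite !writeE kp.
  - by move=> v c; rewrite /fld !writeE; apply: old.
  - by move=> r'; rewrite /fld !writeE; apply: new.
  move=> a' t' r' r5'; rewrite mem_rcons inE => /orP[/eqP[-> -> ->]|/(cand _ _ _ r5')];
    rewrite /fld !writeE // -/(fld n s u (fNew + r)) -/z; clear -zw; lia.
apply: (seq_store n0 hW); rewrite ?writeE //= ?sU //.
apply/halts_seq/halts_const; first by clear -a5 W5; lia.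
apply: (seq_store n0 hW); rewrite ?writeE //= ?sU //.
apply/halts_seq/halts_const; first by clear -t5 W5; lia.
apply: (seq_store n0 hW); rewrite ?writeE //= ?sU //.
do 2!apply: halts_skip; set s' := write_heap _ _ _.
have s'E v c : c < 32 -> fld n s' v c =
    if (v == u) && (c == 19 + r) then t else
    if (v == u) && (c == 14 + r) then a else
    if (v == u) && (c == 9 + r) then z else fld n s v c.
  by move=> c32; rewrite /fld /s' !writeE !cell_eq.
split.
- by move=> x x10; rewrite /s' !writeE !main_neq_scratch // fr.
- by move=> b bn; rewrite /s' !writeE !input_neq_cell // kp.
- move=> v c c32 vc; rewrite s'E // !ifF ?old //; clear -vc r5; lia.
- move=> r' r5'; have [-> | r'r] := eqVneq r' r.
    rewrite !s'E // !eqxx /=.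
    have -> : (9 + r == 19 + r) = false by clear; lia.
    have -> : (9 + r == 14 + r) = false by clear; lia.
    have -> : (14 + r == 19 + r) = false by clear; lia.
    by split=> //; apply: leq_trans wK; clear -zw; lia.
  rewrite !s'E; try by clear -r5'; lia.
  by rewrite !ifF; try (by clear -r5 r5' r'r; lia); apply: new.
move=> a' t' r' r5'; rewrite s'E; last by clear -r5'; lia.
rewrite mem_rcons inE => /orP[/eqP[-> -> ->]|old'].
  rewrite !eqxx /=.
  have -> : (9 + r == 19 + r) = false by clear; lia.
  have -> : (9 + r == 14 + r) = false by clear; lia.
  by [].
have := cand _ _ _ r5' old'; have [-> h | r'r] := eqVneq r' r.
  rewrite !eqxx /=.
  have -> : (9 + r == 19 + r) = false by clear; lia.
  have -> : (9 + r == 14 + r) = false by clear; lia.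
  by apply: leq_trans h; clear -zw; lia.
by rewrite !ifF; try (by clear -r5 r5' r'r; lia).
Qed.

End Relaxation.

Section Merge.
Variables n W : nat.
Hypotheses (n0 : 0 < n) (hW : 64 * n.+1 ^ 2 <= W).

Lemma copy_spec s : regs s rB = n.*2 -> regs s rU < n -> regs s rP < n ->
  (forall r, r < 5 -> fld n s (regs s rU) (fNew + r) <= W) ->
  halts W (block (map copy_code (iota 0 5))) s (fun s' => [/\ frame s s', keeps n s s',
    forall r, r < 5 -> fld n s' (regs s rP) (fTab + r) = fld n s (regs s rU) (fNew + r) &
    forall v c, c < 32 -> ~~ [&& v == regs s rP, 4 <= c & c < 9] ->
      fld n s' v c = fld n s v c]).
Proof.
move=> sB un pn nW; set u := regs s rU in un nW *; set p := regs s rP in pn *.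
pose copied (l : seq nat) s' := [/\ frame s s', keeps n s s',
  forall r, r < 5 -> r \in l -> fld n s' p (fTab + r) = fld n s u (fNew + r) &
  forall v c, c < 32 -> ~~ [&& v == p, 4 <= c & c < 9] -> fld n s' v c = fld n s v c].
apply: halts_weaken (halts_block_map (I := copied) _ _) _ => // [|s' [fr kp new old]].
  move=> l r s1; rewrite mem_iota => /= r5 [fr kp new old].
  have uE : fld n s1 u (fNew + r) = fld n s u (fNew + r).
    by apply: old; clear -r5; lia.
  rewrite /copy_code /=; apply: (seq_load n0 hW); rewrite ?fr -?/u //.
  - by clear -r5; lia.
  - by rewrite -/(fld n s1 u (fNew + r)) uE nW.
  apply: (seq_store n0 hW); rewrite ?writeE /= ?fr //; first by clear -r5; lia.
  apply: halts_skip; split.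
  - by move=> x x10; rewrite !writeE !main_neq_scratch // fr.
  - by move=> a an; rewrite !writeE input_neq_cell // kp.
  - move=> r' r5'; rewrite mem_rcons inE /fld !writeE cell_eq; try by clear -r5 r5'; lia.
    rewrite eqxx eqn_add2l; case: (eqVneq r' r) => [-> _|_ /(new _ r5') //].
    by rewrite -/(fld n s1 u (fNew + r)) uE.
  move=> v c c32 h; rewrite /fld !writeE cell_eq //; last by clear -r5; lia.
  by rewrite ifF; [apply: old | clear -h r5; lia].
by split=> // r r5; apply: new => //; rewrite mem_iota.
Qed.

Lemma merge_spec s :
  regs s rB = n.*2 -> regs s rInf = n.*2.+1 ->
  regs s rU < n -> regs s rP < n -> regs s rU != regs s rP ->
  let u := regs s rU in let p := regs s rP in
  (forall b, b < 5 -> fld n s p (fTab + b) <= n.*2.+1) ->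
  (forall b, b < 5 -> fld n s u (fTab + b) <= n.*2.+1) ->
  halts W merge_code s (fun s' =>
    [/\ frame s s', keeps n s s',
        forall v c, c < 32 -> ~~ [&& v == u, 9 <= c & c < 24] ->
          ~~ [&& v == p, 4 <= c & c < 9] -> fld n s' v c = fld n s v c,
        forall a t r, a < 5 -> t < 5 -> absorb a t = Some r ->
          fld n s' p (fTab + r) <= fld n s p (fTab + a) + fld n s u (fTab + t)
      & forall r, r < 5 -> fld n s' p (fTab + r) <= n.*2.+1 /\
         (fld n s' p (fTab + r) < n.*2.+1 ->
          let a := fld n s' u (fOwn + r) in let t := fld n s' u (fSub + r) in
          [/\ a < 5, t < 5, absorb a t = Some r &
              fld n s' p (fTab + r) = fld n s p (fTab + a) + fld n s u (fTab + t)])]).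
Proof.
have [W1 W2] := big_word n0 hW; have nW : (n.*2.+1).*2 <= W by clear -W1; lia.
move=> sB sI un pn up u p pK uK.
apply: halts_seq; apply: halts_weaken (new_spec n0 hW sB un sI) _ => s1 [fr1 kp1 new1 old1].
have s1B : regs s1 rB = n.*2 by rewrite fr1.
have s1U : regs s1 rU = u by rewrite fr1.
have s1P : regs s1 rP = p by rewrite fr1.
have p1 b : b < 5 -> fld n s1 p (fTab + b) = fld n s p (fTab + b).
  by move=> b5; apply: old1; clear -b5; lia.
have u1 b : b < 5 -> fld n s1 u (fTab + b) = fld n s u (fTab + b).
  by move=> b5; apply: old1; clear -b5; lia.
have rel1 : relaxed n s1 [::] s1.
  split=> // r r5; rewrite s1U new1 //; split=> //.
  by rewrite ltnn.
apply: halts_seq; apply: halts_weaken (halts_block_map (I := relaxed n s1) rel1 _) _.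
  move=> l [[a t] r] s' e_tab rel; apply: (relax_spec n0 hW) => //.
  - by rewrite s1U.
  - by rewrite s1P.
  - by rewrite s1U s1P.
  - by move=> b b5; rewrite s1P p1 ?pK.
  - by move=> b b5; rewrite s1U u1 ?uK.
move=> s2 [fr2 kp2 old2 new2 done2].
have s2B : regs s2 rB = n.*2 by rewrite fr2.
have s2U : regs s2 rU = u by rewrite fr2.
have s2P : regs s2 rP = p by rewrite fr2.
rewrite s1U s1P in old2 new2 done2.
apply: halts_seq; apply: halts_weaken (copy_spec s2B _ _ _) _ => [|||s3 [fr3 kp3 new3 old3]].
- by rewrite s2U.
- by rewrite s2P.
- by move=> r r5; rewrite s2U; have [h _] := new2 r r5; clear -h nW; lia.
rewrite s2U s2P in new3 old3.
apply: halts_skip; split.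
- by move=> x x10; rewrite fr3 // fr2 // fr1.
- by move=> a an; rewrite kp3 // kp2 // kp1.
- by move=> v c c32 h1 h2; rewrite old3 // old2 // old1.
- move=> a t r a5 t5 atr; have r5 := absorb_lt5 a5 t5 atr.
  rewrite new3 // -(p1 a a5) -(u1 t t5); apply: done2 => //.
  by apply/absorb_tableP.
move=> r r5; rewrite new3 //; have [h1 h2] := new2 r r5; split=> // /h2.
have upF : (u == p) = false by apply: negbTE.
case=> /absorb_tableP[]; rewrite !old3 ?upF //; try by clear -r5; lia.
by move=> a5 t5 atr ->; rewrite p1 ?u1.
Qed.

End Merge.

Section Rest.
Variables n W : nat.
Hypotheses (n0 : 0 < n) (hW : 64 * n.+1 ^ 2 <= W).

Lemma select_spec s :
  regs s rB = n.*2 -> regs s rP < n ->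
  let p := regs s rP in
  (forall b, b < 5 -> fld n s p (fTab + b) <= W) ->
  halts W select_code s (fun s' =>
    [/\ frame s s', keeps n s s',
        forall v c, c < 32 -> ~~ ((v == p) && (c == 3)) -> fld n s' v c = fld n s v c,
        2 <= fld n s' p fSol < 5 /\ fld n s p (fTab + fld n s' p fSol) = regs s' rX
      & regs s' rX = minn (fld n s p 6) (minn (fld n s p 7) (fld n s p 8))]).
Proof.
rewrite /fld => sB pn tW.
have [W1 W2] := big_word n0 hW; have W5 : 5 <= W by clear -W2; lia.
have t6 := tW 2 isT.
have choose_ok b s1 : 2 <= b < 5 -> frame s s1 -> heap s1 = heap s ->
    regs s1 rX = heap s (cell n (regs s rP) (4 + regs s1 rZ)) ->
    2 <= regs s1 rZ < 5 ->
  halts W (choose_code b) s1 (fun s2 => [/\ frame s s2, heap s2 = heap s,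
    regs s2 rX = heap s (cell n (regs s rP) (4 + regs s2 rZ)), 2 <= regs s2 rZ < 5
    & regs s2 rX = minn (regs s1 rX) (heap s (cell n (regs s rP) (4 + b)))]).
  move=> b25 fr hp xE z25; have hb := tW b ltac:(clear -b25; lia).
  have xW : regs s1 rX <= W by rewrite xE tW //; clear -z25; lia.
  rewrite /choose_code /=.
  have b32 : 4 + b < 32 by clear -b25; lia.
  have s1B : regs s1 rB = n.*2 by rewrite fr.
  have s1P : regs s1 rP = regs s rP by rewrite fr.
  apply: (seq_load n0 hW); rewrite ?s1B ?s1P ?hp //.
  apply/halts_seq/halts_sub; rewrite !writeE /=; first by clear -xW; lia.
  apply/halts_seq/halts_if; rewrite !writeE /= => d.
    apply/halts_seq/halts_move; rewrite !writeE //=.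
    apply/halts_seq/halts_const; first by clear -b25 W5; lia.
    do 2!apply: halts_skip; rewrite !writeE /= hp; split=> //.
      by move=> x x10; rewrite !writeE !main_neq_scratch // fr.
    by clear -d; lia.
  do 2!apply: halts_skip; rewrite !writeE /= hp; split=> //.
    by move=> x x10; rewrite !writeE !main_neq_scratch // fr.
  by clear -d; lia.
rewrite /select_code /=; apply: (seq_load n0 hW) => //.
apply/halts_seq/halts_const; first by clear -W5; lia.
apply: halts_seq; set s0 := write_reg _ rZ _.
have fr0 : frame s s0 by move=> x x10; rewrite /s0 !writeE !main_neq_scratch.
have x0 : regs s0 rX = heap s (cell n (regs s rP) (4 + regs s0 rZ)).
  by rewrite /s0 !writeE.
have z0 : 2 <= regs s0 rZ < 5 by rewrite /s0 !writeE.
have hp0 : heap s0 = heap s by rewrite /s0 !writeE.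
apply: halts_weaken (choose_ok 3 s0 isT fr0 hp0 x0 z0) _.
move=> s1 [fr1 hp1 x1 z1 m1]; apply: halts_seq.
apply: halts_weaken (choose_ok 4 s1 isT fr1 hp1 x1 z1) _.
move=> s2 [fr2 hp2 x2 z2 m2].
have s2B : regs s2 rB = n.*2 by rewrite fr2.
have s2P : regs s2 rP = regs s rP by rewrite fr2.
apply: (seq_store n0 hW); rewrite ?s2P //.
apply: halts_skip; rewrite !writeE; split.
- by move=> x x10; rewrite !writeE !main_neq_scratch // fr2.
- by move=> a an; rewrite !writeE input_neq_cell // hp2.
- by move=> v c c32 h; rewrite !writeE cell_eq // (negbTE h) hp2.
- by rewrite eqxx x2; split.
by rewrite /= m2 m1 x0 /s0 !writeE minnA.
Qed.

Lemma out_spec s : regs s rB = n.*2 -> regs s rOne = 1 -> regs s rI < n ->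
  let v := regs s rI in 0 < regs s rK ->  regs s rK <= n ->
  fld n s v fSol < 5 ->
  halts W out_body s (fun s' =>
    [/\ forall x, x < 4 -> regs s' x = regs s x,
        regs s' rK = (regs s rK).-1, regs s' rI = v.+1
      & forall a, heap s' a = if a == v then fld n s v fSol - 2 else heap s a]).
Proof.
rewrite /fld => sB s1 vn k0 kn h.
have [W1 W2] := big_word n0 hW; have W5 : 5 <= W by clear -W2; lia.
rewrite /out_body /=; apply: (seq_load n0 hW) => //; first by clear -h W5; lia.
apply/halts_seq/halts_const; first by clear -W5; lia.
apply/halts_seq/halts_sub; rewrite !writeE /=; first by clear -h W5; lia.
apply/halts_seq/halts_store; rewrite !writeE /=.
apply/halts_seq/halts_add; rewrite !writeE /= s1; first by clear -vn W1; lia.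
apply/halts_seq/halts_sub; rewrite !writeE /= ?s1; first by clear -kn W1; lia.
apply: halts_skip; split.
- by move=> x x4; rewrite !writeE !ifF //; clear -x4; lia.
- by rewrite !writeE /= subn1.
- by rewrite !writeE /= addn1.
by move=> a; rewrite !writeE.
Qed.

Lemma back_spec s : regs s rB = n.*2 -> regs s rOne = 1 ->
  0 < regs s rK -> regs s rK <= n ->
  let k := (regs s rK).-1 in let u := fld n s k fQueue in let p := fld n s u fNbr in
  let r := fld n s p fSol in
  u < n -> p < n -> u != p -> r < 5 ->
  fld n s u (fOwn + r) < 5 -> fld n s u (fSub + r) < 5 ->
  halts W back_body s (fun s' =>
    [/\ forall x, x < 4 -> regs s' x = regs s x, regs s' rK = k, keeps n s s'
      & forall v c, c < 32 -> fld n s' v c =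
          if (v == u) && (c == 3) then fld n s u (fSub + r) else
          if (v == p) && (c == 3) then fld n s u (fOwn + r) else fld n s v c]).
Proof.
rewrite /fld => sB s1 k0 kn /=; set k := _.-1; set u := heap s (cell n k 2).
set p := heap s (cell n u 1); set r := heap s _ => un pn up r5 o5 b5.
have [W1 W2] := big_word n0 hW; have W5 : 5 <= W by clear -W2; lia.
have nW : n <= W by clear -W1; lia.
rewrite /back_body /=.
apply/halts_seq/halts_sub; rewrite s1 subn1 -/k; first by rewrite /k; clear -kn nW; lia.
have kn' : k < n by rewrite /k; clear -kn k0; lia.
apply: (seq_load n0 hW); rewrite ?writeE //= -/u; first by clear -un nW; lia.
apply: (seq_load n0 hW); rewrite ?writeE //= -/p; first by clear -pn nW; lia.
apply: (seq_load n0 hW); rewrite ?writeE //= -/r; first by clear -r5 W5; lia.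
apply: (seq_loadx n0 hW); rewrite ?writeE //=; try by clear -r5 o5 W5; lia.
move=> a1 b1; apply: (seq_loadx n0 hW); rewrite ?writeE //=; try by clear -r5 b5 W5; lia.
move=> a2 b2; apply: (seq_store n0 hW); rewrite ?writeE //=.
apply: (seq_store n0 hW); rewrite ?writeE //=.
apply: halts_skip; split.
- by move=> x x4; rewrite !writeE; rewrite !ifF //; clear -x4; lia.
- by rewrite !writeE.
- by move=> a an; rewrite !writeE !input_neq_cell.
by move=> v c c32; rewrite !writeE !cell_eq.
Qed.

End Rest.

(** * Counted loops *)

Definition loop su b := CSeq su (CWhile rK b).
Definition loop_time su b n := max_steps su + ((max_steps b).+1 * n).+1.

Lemma runs_loop W su b s n k (I : nat -> state -> Prop) :
  loopfree su -> loopfree b -> k <= n -> halts W su s (I k) ->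
  (forall k s, I k s -> regs s rK = k) ->
  (forall k s, I k.+1 s -> halts W b s (I k)) ->
  runs W (loop su b) s (loop_time su b n) (I 0).
Proof.
move=> lsu lb kn Is Ir Ib; apply/runs_seq.
have [t [s1 [e le1 I1]]] := runs_halts lsu Is; exists t, s1; split=> //.
have [t2 [s2 [e2 le2 I2]]] := runs_while lb I1 Ir Ib; exists t2, s2; split=> //.
by apply: leq_trans le2 _; rewrite ltnS leq_mul2l kn orbT.
Qed.

(** * Reading the tree *)

Lemma tree_order_gt0 n (T : sgraph 'I_n) : is_tree T -> 0 < n.
Proof. by case=> /andP[]; rewrite card_ord. Qed.

Section Phases.

Variables (n W : nat) (T : sgraph 'I_n) (es : seq ('I_n * 'I_n)).
Hypotheses (hW : 64 * n.+1 ^ 2 <= W) (treeT : is_tree T) (esT : edge_list T es).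

Let n0 : 0 < n := tree_order_gt0 treeT.

Lemma size_es : size es = n.-1.
Proof. by rewrite (size_edge_list treeT esT) card_ord. Qed.

Definition env s := [/\ regs s rN = n, regs s rB = n.*2,
  regs s rInf = n.*2.+1 & regs s rOne = 1].

Lemma env_frame4 s s' : (forall x, x < 4 -> regs s' x = regs s x) -> env s -> env s'.
Proof. by move=> fr [sN sB sI s1]; split; rewrite fr. Qed.

Lemma env_frame s s' : frame s s' -> env s -> env s'.
Proof. by move=> fr; apply: env_frame4 => x x4; apply: fr; clear -x4; lia. Qed.

(** The endpoints are compared as numbers, since records are indexed by numbers. *)
Definition incidence (l : seq ('I_n * 'I_n)) (g : 'I_n -> nat) (v : nat) : nat :=
  \sum_(e <- l) (((e.1 : nat) == v) * g e.2 + ((e.2 : nat) == v) * g e.1).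

Definition weight (c : nat) (w : 'I_n) : nat := if c == 0 then 1 else w.

Lemma incidence_le l c v : incidence l (weight c) v <= size l * n.*2.
Proof.
rewrite /incidence; elim: l => [|e l IH]; first by rewrite big_nil.
rewrite big_cons mulSn leq_add //.
have wn w : weight c w <= n by rewrite /weight; case: ifP => // _; apply: ltnW.
by rewrite -addnn leq_add // mulnbl; case: ifP.
Qed.

Lemma input_edge es1 e es2 : es = es1 ++ e :: es2 ->
  heap (init es) (size es1).*2.+1 = e.1 /\ heap (init es) (size es1).*2.+2 = e.2.
Proof.
move=> ->; rewrite /=; elim: es1 => [|e1 es1 IH] //=.
Qed.

Lemma input_tail a : n.*2 <= a -> heap (init es) a = 0.
Proof.
move=> an; rewrite /= nth_default //=.
rewrite (_ : size _ = (size es).*2); first by rewrite size_es; clear -an n0; lia.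
by elim: es => [|e l IH] //=; rewrite IH.
Qed.

(** Invariant of the first loop: degrees and neighbour sums count the edges
    [es1] read so far, and [k] edges remain. *)
Definition edges_read k s := exists es1 es2,
  [/\ es = es1 ++ es2, size es2 = k, env s /\ regs s rK = k,
      regs s rI = (size es1).*2.+1 /\ (forall a, a < n.*2 -> heap s a = heap (init es) a)
    & forall v c, c < 2 -> fld n s v c = incidence es1 (weight c) v].

Lemma setup_spec : halts W setup (init es) (edges_read n.-1).
Proof.
have [W1 W2] := big_word n0 hW; have nW : n.*2.+1 <= W by clear -W1; lia.
rewrite /setup /=.
apply/halts_seq/halts_load; first by rewrite /=; clear -nW; lia.
apply/halts_seq/halts_add; rewrite !writeE /=; first by clear -nW; lia.
apply/halts_seq/halts_const; first by clear -nW; lia.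
apply/halts_seq/halts_add; rewrite !writeE /=; first by clear -nW; lia.
apply/halts_seq/halts_sub; rewrite !writeE /=; first by clear -nW; lia.
apply/halts_seq/halts_const; first by clear -nW; lia.
apply: halts_skip; exists [::], es; split=> //.
- exact: size_es.
- by rewrite /env !writeE /= addn1 addnn subn1.
- by split=> [|a an]; rewrite !writeE.
move=> v c c2; rewrite /incidence big_nil /fld !writeE input_tail // /cell; clear; lia.
Qed.

Lemma edge_spec k s : edges_read k.+1 s -> halts W edge_body s (edges_read k).
Proof.
have [W1 W2] := big_word n0 hW.
case=> es1 [[|e es2]] [esE // [ke] [[sN sB sI s1] sK] [rI inp] cnt].
have [in1 in2] := input_edge esE.
have sz : size es1 + k.+1 = n.-1 by rewrite -size_es esE size_cat /= ke.
have [e1n e2n] := (ltn_ord e.1, ltn_ord e.2).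
rewrite /edge_body /=.
apply/halts_seq/halts_load; rewrite rI inp; try by clear -sz W1 e1n; lia.
  by rewrite in1; clear -e1n W1; lia.
rewrite in1; apply/halts_seq/halts_add; rewrite !writeE /= rI s1 ?addn1.
  by clear -sz W1; lia.
apply/halts_seq/halts_load; rewrite !writeE /= inp; try by clear -sz W1 e1n; lia.
  by rewrite in2; clear -e2n W1; lia.
rewrite in2; apply/halts_seq/halts_add; rewrite !writeE /= s1 ?addn1.
  by clear -sz W1; lia.
set s2 := write_reg _ _ _.
have s2f v c : fld n s2 v c = fld n s v c by rewrite /fld /s2 !writeE.
have cnt_le v c : c < 2 -> fld n s v c + n.*2.+2 <= W.
  move=> c2; rewrite cnt //; have := incidence_le es1 c v.
  have : size es1 * n.*2 <= n * n.*2 by rewrite leq_mul2r; clear -sz; lia.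
  by clear -W2 n0; nia.
have [s2U s2P] : regs s2 rU = e.1 /\ regs s2 rP = e.2 by rewrite /s2 !writeE.
have [s2B s2o] : regs s2 rB = n.*2 /\ regs s2 rOne = 1 by rewrite /s2 !writeE.
apply: halts_seq; apply: halts_weaken (bump_spec n0 hW (u := rU) (p := rP) _ _ _ _ _ _ _ _) _;
  rewrite ?s2U ?s2P ?s2f //.
- by have := cnt_le e.1 0 isT; clear -n0; lia.
- by have := cnt_le e.1 1 isT; clear -e2n; lia.
move=> s3 [fr3 kp3 f3].
have [s3U s3P] : regs s3 rU = e.1 /\ regs s3 rP = e.2 by rewrite !fr3.
have [s3B s3o] : regs s3 rB = n.*2 /\ regs s3 rOne = 1 by rewrite !fr3.
have f3_le v c : c < 2 -> fld n s3 v c <= fld n s v c + n.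
  move=> c2; rewrite f3 ?s2f; last by clear -c2; lia.
  rewrite leq_add2l mulnbl; case: ifP => // _; case: c c2 => [|[|]] //= _.
  by clear -n0 e2n; lia.
apply: halts_seq; apply: halts_weaken (bump_spec n0 hW (u := rP) (p := rU) _ _ _ _ _ _ _ _) _;
  rewrite ?s3U ?s3P //.
- by have := cnt_le e.2 0 isT; have := f3_le e.2 0 isT; clear -n0; lia.
- by have := cnt_le e.2 1 isT; have := f3_le e.2 1 isT; clear -e1n; lia.
move=> s4 [fr4 kp4 f4].
have fr42 x : x < 10 -> regs s4 x = regs s2 x by move=> x10; rewrite fr4 ?fr3.
have s4K : regs s4 rK = k.+1 by rewrite fr42 // /s2 !writeE.
have s4o : regs s4 rOne = 1 by rewrite fr42.
apply/halts_seq/halts_sub; rewrite s4K s4o subn1 /=; first by clear -sz W1; lia.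
apply: halts_skip; exists (rcons es1 e), es2; split=> //.
- by rewrite cat_rcons.
- by split; rewrite /env !writeE ?fr42 // /s2 !writeE.
- split; first by rewrite !writeE fr42 // /s2 !writeE /= size_rcons.
  by move=> a an; rewrite !writeE kp4 // kp3 // /s2 !writeE inp.
move=> v c c2; have c32 : c < 32 by clear -c2; lia.
rewrite /fld !writeE -/(fld n s4 v c) f4 // f3 // s2f cnt //.
rewrite /incidence -cats1 big_cat big_seq1 /= -addnA; congr (_ + (_ + _)).
  by rewrite eq_sym /weight; case: c c2 c32 => [|[|]] //= _ _; rewrite add0n mul1n.
by rewrite eq_sym /weight; case: c c2 c32 => [|[|]] //= _ _; rewrite add0n mul1n.
Qed.

Definition counts (X : {set 'I_n}) s : Prop :=
  {in X, forall v : 'I_n, fld n s v fDeg = #|nbrs T X v|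
     /\ fld n s v fNbr = \sum_(w in nbrs T X v) w}.

Definition queue (q : seq 'I_n) s : Prop :=
  [/\ uniq q, regs s rT = size q
    & forall i, i < size q -> fld n s i fQueue = nth 0 (map val q) i].

Lemma queue_lt (q : seq 'I_n) v : uniq q -> v \notin q -> size q < n.
Proof.
move=> q_u vq; have : uniq (v :: q) by rewrite /= vq.
by move/card_uniqP => /= <-; rewrite -[X in _ <= X]card_ord max_card.
Qed.

Lemma queue_eq q s s' : queue q s -> regs s' rT = regs s rT ->
  (forall i, fld n s' i fQueue = fld n s i fQueue) -> queue q s'.
Proof.
by case=> q_u qT qE sT f; split=> // [|i iq]; rewrite ?sT // f qE.
Qed.

Lemma queue_push q (v : 'I_n) s s' (b : bool) :
  queue q s -> (b -> v \notin q) -> regs s' rT = regs s rT + b ->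
  (forall i, fld n s' i fQueue = if b && (i == regs s rT) then (v : nat) else fld n s i fQueue) ->
  queue (if b then rcons q v else q) s'.
Proof.
case=> q_u qT qE + sT f; case: b sT f => [sT f /(_ isT) vq|sT f _].
  split; first by rewrite rcons_uniq vq.
    by rewrite sT qT size_rcons addn1.
  move=> i; rewrite size_rcons ltnS f qT /= map_rcons nth_rcons size_map => iq.
  case: (ltngtP i (size q)) iq => // iq _; first by rewrite qE.
split=> // [|i iq]; first by rewrite sT addn0.
by rewrite f qE.
Qed.

Lemma counts_read s : edges_read 0 s -> counts setT s.
Proof.
case=> es1 [es2] [esE /size0nil e20 _ _ cnt] v _.
rewrite e20 cats0 in esE; rewrite -esE in cnt.
have sumE g : incidence es g v = \sum_(w in nbrs T setT v) g w.
  rewrite -[LHS]/(\sum_(e <- es) ((e.1 == v) * g e.2 + (e.2 == v) * g e.1)).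
  by rewrite (sum_edge_list _ _ esT); apply: eq_bigl => w; rewrite !inE.
rewrite !cnt // !sumE; split; last by apply: eq_bigr.
by rewrite /weight /= sum1_card.
Qed.

(** Invariant of the second loop, with [k] vertices to go. *)
Definition tables_ready k s : Prop :=
  [/\ env s /\ regs s rK = k, k <= n /\ regs s rI = n - k, counts setT s,
      forall v : 'I_n, v < n - k -> forall t, t < 5 ->
        fld n s v (fTab + t) = leaf_table n.*2.+1 t
    & exists q, queue q s /\
        forall v, (v \in q) = (v < n - k) && (#|nbrs T setT v| == 1)].

Lemma table_setup_spec s : edges_read 0 s -> halts W table_setup s (tables_ready n).
Proof.
have [W1 W2] := big_word n0 hW; move=> er; have cnt := counts_read er.
case: er => _ [_] [_ _ [[sN sB sI s1] _] _ _].
rewrite /table_setup /=.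
apply/halts_seq/halts_move; first by rewrite sN; clear -W1; lia.
apply/halts_seq/halts_const => //.
apply/halts_seq/halts_const => //.
apply: halts_skip; split; rewrite ?subnn //.
- by rewrite /env !writeE.
- by rewrite !writeE.
- by move=> v vT; rewrite /fld !writeE; apply: cnt.
by exists [::]; split=> //; split; rewrite ?writeE.
Qed.

Lemma nbrs_le X v : #|nbrs T X v| <= n.
Proof. by rewrite -[X in _ <= X]card_ord max_card. Qed.

Lemma table_spec k s : tables_ready k.+1 s -> halts W table_body s (tables_ready k).
Proof.
have [W1 W2] := big_word n0 hW.
case=> -[es_ sK] [kn sI] cnt tab [q [qs qE]].
have [sN sB sInf s1] := es_.
have vn : n - k.+1 < n by clear -kn; lia.
set v : 'I_n := Ordinal vn.
have vE : regs s rI = v by rewrite sI.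
have vq : v \notin q by rewrite qE ltnn.
rewrite /table_body /=; apply: halts_seq.
apply: halts_weaken (leaf_table_spec n0 hW sB s1 sInf _) _ => [|s1' [fr1 kp1 new1 old1]].
  by rewrite vE.
have e1 := env_frame fr1 es_; have [_ sB1 _ s11] := e1.
have s1I : regs s1' rI = v by rewrite fr1.
have f0 : fld n s1' v fDeg = #|nbrs T setT v|.
  by rewrite old1 ?andbF // (proj1 (cnt v _)).
apply: halts_seq; apply: halts_weaken (push_spec n0 hW (v := rI) _ _ _ _ _ _ _) _;
  rewrite ?s1I ?f0 //.
- exact: nbrs_le.
- move=> _; rewrite fr1 //; have [q_u -> _] := qs; exact: queue_lt vq.
move=> s2 [fr2 rT2 kp2 f2].
have e2 : env s2 by apply: env_frame4 e1 => x x4; apply: fr2; clear -x4; lia.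
have [_ sB2 _ s12] := e2.
have s2I : regs s2 rI = v by rewrite fr2.
have s2K : regs s2 rK = k.+1 by rewrite fr2 // fr1.
apply/halts_seq/halts_add; rewrite s2I s12 addn1; first by clear -W1 vn; rewrite /=; lia.
apply/halts_seq/halts_sub; rewrite !writeE /= s2K s12 subn1 /=; first by clear -W1 kn; lia.
have f21 (w : nat) c : c < 32 -> c != 2 -> fld n s2 w c = fld n s1' w c.
  by move=> c32 c2; rewrite f2 // (negbTE c2) !andbF.
have nk : n - k = (n - k.+1).+1 by clear -kn; lia.
apply: halts_skip; split.
- by split; rewrite /env !writeE.
- by split; [clear -kn; lia | rewrite !writeE /= nk].
- move=> w wT; rewrite /fld !writeE -!/(fld n s2 _ _) !f21 // !old1 ?andbF //.
  exact: cnt.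
- move=> w; rewrite nk ltnS leq_eqVlt => wk t t5.
  have t32 : 4 + t < 32 by clear -t5; lia.
  rewrite /fld !writeE -!/(fld n s2 _ _) f21 //.
  case/orP: wk => [/eqP wv|wk].
    by rewrite wv -sI new1.
  rewrite old1 // ?tab // vE negb_and; apply/orP; left.
  by rewrite neq_ltn wk.
have qs1 : queue q s1'.
  by apply: queue_eq qs _ _ => [|i]; rewrite ?fr1 // old1 ?andbF.
exists (if #|nbrs T setT v| == 1 then rcons q v else q); split.
  apply: (@queue_eq _ s2) => [||i]; rewrite ?writeE //; last by rewrite /fld !writeE.
  by apply: queue_push qs1 _ rT2 _ => // i; rewrite f2 ?andbT.
move=> w; rewrite nk ltnS leq_eqVlt -[n - k.+1]/(val v).
have -> : (w : nat) == val v = (w == v) by [].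
case: ifP => d; rewrite ?mem_rcons ?inE qE.
  by have [->|] := eqVneq w v; rewrite //= d.
by have [->|] := eqVneq w v; rewrite //= d ltnn.
Qed.

End Phases.

(** * Pruning *)

Section Trace.

Variables (n K : nat) (T : sgraph 'I_n).
Implicit Types (m : nat -> nat -> nat) (us : seq 'I_n) (X : {set 'I_n})
  (A : 'I_n -> nat -> nat).

(** The memory [m] records how the vertices [us], the latest first, were pruned
    and led from the whole tree to the remaining vertices [X] with tables [A]. The
    earlier tables are overwritten in the memory and exist in this history
    only. *)
Fixpoint trace m us X A : Prop :=
  match us with
  | [::] => X = setT /\ forall v s, s < 5 -> A v s = leaf_table K s
  | u :: us' => exists X' A' (p : 'I_n),
      [/\ trace m us' X' A', leaf T X' u p, m u fNbr = p, X = X' :\ u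
        & merged K X' A' A u p (fun r => m u (fOwn + r)) (fun r => m u (fSub + r))]
  end.

Lemma trace_frame m m' us X A :
  (forall u : 'I_n, u \in us -> m' u fNbr = m u fNbr) ->
  (forall u : 'I_n, u \in us -> forall r, r < 5 ->
    m' u (fOwn + r) = m u (fOwn + r) /\ m' u (fSub + r) = m u (fSub + r)) ->
  trace m us X A -> trace m' us X A.
Proof.
elim: us X A => [|u us IH] X A //= eq1 eqC [X' [A' [p [tr lf up XE [mk mle mch]]]]].
exists X', A', p; split=> //.
- by apply: IH tr => v vus; [apply: eq1 | apply: eqC]; rewrite inE vus orbT.
- by rewrite eq1 ?mem_head.
split=> // r r5; have [-> ->] := eqC u (mem_head _ _) r r5.
exact: mch.
Qed.

End Trace.

Section Pruning.

Variables (n W : nat) (T : sgraph 'I_n) (es : seq ('I_n * 'I_n)).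
Hypotheses (hW : 64 * n.+1 ^ 2 <= W) (treeT : is_tree T) (esT : edge_list T es).
Let n0 : 0 < n := tree_order_gt0 treeT.

Definition tab s (v : 'I_n) t := fld n s v (fTab + t).

(** Invariant of the pruning loop, with [k] vertices to prune. The queue starts
    with the pruned vertices. Its other members have degree at most 1: degree 0
    occurs when only two leaves are left and one of them is pruned, while the other
    one is waiting in the queue. *)
Definition pruned k s : Prop := exists us X q,
  [/\ [/\ env n s, regs s rK = k, regs s rI = size us & size us + k = n.-1],
      [/\ connected_in T X, #|X| = k.+1, forall v, (v \in X) = (v \notin us)
        & exists2 r : 'I_n, r \in X & regs s rP = r],
      counts T X s /\ [/\ queue q s, rev us = take (size us) q &
        {in X, forall v, (#|nbrs T X v| = 1 -> v \in q) /\
                         (v \in q -> #|nbrs T X v| <= 1)}],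
      forall (v : 'I_n) t, t < 5 -> tab s v t <= n.*2.+1
    & lower T X (tab s) (gammaB2 T) /\
      trace n.*2.+1 T (fld n s) us X (tab s)].

Lemma leaf_table_le K s : 2 <= K -> leaf_table K s <= K.
Proof. by rewrite /leaf_table; do 3?case: ifP => // _; lia. Qed.

Lemma prune_setup_spec s : tables_ready T 0 s -> halts W prune_setup s (pruned n.-1).
Proof.
have [W1 W2] := big_word n0 hW.
case=> -[[sN sB sI s1] sK] [_ rI] cnt tb [q [qs qE]].
have tbE v t : t < 5 -> tab s v t = leaf_table n.*2.+1 t.
  by move=> t5; apply: tb => //; rewrite subn0.
rewrite /prune_setup /=.
apply/halts_seq/halts_sub; first by rewrite sN; clear -W1; lia.
apply/halts_seq/halts_const => //; apply/halts_seq/halts_const => //.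
apply: halts_skip; set s' := write_reg _ _ _.
have ff v c : fld n s' v c = fld n s v c by rewrite /fld /s' !writeE.
have tbE' v t : t < 5 -> tab s' v t = leaf_table n.*2.+1 t.
  by move=> t5; rewrite /tab ff -/(tab s v t) tbE.
exists [::], setT, q; split.
- by split; rewrite /env /s' ?writeE //= sN s1 subn1.
- split; first by case: treeT => /connected_setT.
  + by rewrite cardsT card_ord prednK.
  + by move=> v; rewrite inE.
  by exists (Ordinal n0); rewrite ?inE // /s' !writeE.
- split; first by move=> v vT; rewrite !ff; apply: cnt.
  split; rewrite ?take0 //.
    by apply: queue_eq qs _ _ => [|i]; rewrite ?ff // /s' !writeE.
  move=> v _; rewrite qE subn0 ltn_ord /=; split=> [->//|/eqP->//].
- by move=> v t t5; rewrite tbE' //; apply: leaf_table_le; clear -n0; lia.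
split; last by split=> // v t; apply: tbE'.
by apply: (lower_init _ tbE'); case: treeT.
Qed.

Lemma sum_nbrsD1 (X : {set 'I_n}) u p v : leaf T X u p -> v \in X :\ u ->
  \sum_(w in nbrs T X v) (w : nat) =
  \sum_(w in nbrs T (X :\ u) v) (w : nat) + (v == p) * u.
Proof.
move=> lf vX; rewrite (nbrsD1 lf vX); have [uX pX uP] := lf.
have [->|] := eqVneq v p; last by rewrite mul0n addn0.
rewrite (big_setD1 u) /=; last by rewrite inE uX adj_sym uP // eqxx.
by rewrite mul1n addnC.
Qed.

(** Since at least two vertices remain, there is a leaf, so the queue has an
    unprocessed member [u], which is a leaf because connectedness excludes degree
    0. Only the records of [u] and of its neighbour and the new queue entry
    change, so that the history of the pruned vertices stays valid. *)
Lemma prune_spec k s : pruned k.+1 s -> halts W prune_body s (pruned k).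
Proof.
have [W1 W2] := big_word n0 hW.
case=> us [X [q [[e sK sI szus] [cX cardX XE _] [cnt [qs usE qX]] tabK [low tr]]]].
have [sN sB sInf s1] := e; have [q_u qT qE] := qs.
set j := size us in sI szus usE.
have X2 : 1 < #|X| by rewrite cardX.
have [_ acT] := treeT.
have [x xX x1] := exists_leaf acT cX X2.
have take_us v : (v \in take j q) = (v \in us) by rewrite -usE mem_rev.
have jq : j < size q.
  rewrite ltnNge; apply/negP => qj; have := (qX x xX).1 x1.
  by rewrite -(take_oversize qj) take_us; apply/negP; rewrite -XE.
have qn : size q <= n.
  by rewrite -[X in _ <= X]card_ord -(card_uniqP q_u) max_card.
pose u := nth (Ordinal n0) q j.
have uq : u \in q by apply: mem_nth.
have uX : u \in X.
  rewrite XE -take_us; move: q_u; rewrite -{1}(cat_take_drop j q).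
  by rewrite (drop_nth (Ordinal n0) jq) cat_uniq => /and3P[_ /hasPn/(_ u (mem_head _ _))].
have u1 : #|nbrs T X u| = 1.
  by apply/eqP; rewrite eqn_leq (qX u uX).2 // nbrs_gt0.
have [p lf nE] := leaf_of_nbrs1 uX u1; have [_ pX uP] := lf.
have upN := leaf_neq lf.
have fu1 : fld n s u fNbr = p by rewrite (cnt u uX).2 nE big_set1.
have fj2 : fld n s j fQueue = u.
  by rewrite qE // (nth_map (Ordinal n0)).
have pX' : p \in X :\ u by rewrite !inE eq_sym upN.
have degp := card_nbrsD1 lf pX'; have sump := sum_nbrsD1 lf pX'.
rewrite eqxx in degp sump; rewrite mul1n in sump.
have un : u < n by []; have pn : p < n by [].
have jn : j < n by apply: leq_trans jq qn.
rewrite /prune_body /=.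
apply: (seq_load n0 hW); rewrite ?sI -?/(fld n s j fQueue) ?fj2 //; first by clear -un W1; lia.
apply: (seq_load n0 hW); rewrite ?writeE //= -/(fld n s u fNbr) ?fu1; first by clear -pn W1; lia.
set s0 := write_reg _ rP _.
have f0 v c : fld n s0 v c = fld n s v c by rewrite /fld /s0 !writeE.
have e0 : env n s0 by rewrite /env /s0 !writeE.
have [s0N s0B s0I s01] := e0.
have s0U : regs s0 rU = u by rewrite /s0 !writeE.
have s0P : regs s0 rP = p by rewrite /s0 !writeE.
have [cp0 cp1] := cnt p pX.
apply: halts_seq; apply: halts_weaken (unlink_spec n0 hW s0B s01 _ _ _ _) _;
  rewrite ?s0U ?s0P ?f0 //.
- by rewrite cp0 (leq_trans (nbrs_le _ _ _)) //; clear -W1; lia.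
- rewrite cp1; apply: (@leq_trans (\sum_(w in 'I_n) n)).
    rewrite [X in _ <= X](bigID (mem (nbrs T X p))) /=.
    by apply: leq_trans (leq_addr _ _); apply: leq_sum => w _; apply: ltnW.
  by rewrite sum_nat_const card_ord; clear -W2; lia.
move=> s2 [fr2 kp2 f2].
have e2 := env_frame fr2 e0; have [s2N s2B s2I s21] := e2.
have s2U : regs s2 rU = u by rewrite fr2.
have s2P : regs s2 rP = p by rewrite fr2.
have s2T : regs s2 rT = size q by rewrite fr2 // /s0 !writeE.
have p0 : fld n s2 p fDeg = #|nbrs T (X :\ u) p|.
  by rewrite f2 // f0 cp0 degp eqxx !mul1n mul0n addn0 addnK.
have pq : #|nbrs T (X :\ u) p| == 1 -> p \notin q.
  by move=> /eqP d1; apply/negP => /(qX p pX).2; rewrite degp d1.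
apply: halts_seq; apply: halts_weaken (push_spec n0 hW (v := rP) _ _ s2B s21 _ _ _) _;
  rewrite ?s2P ?p0 ?s2T //.
- exact: nbrs_le.
- by move=> d1; apply: (queue_lt q_u (pq _)); rewrite d1.
set b := _ == 1; move=> s3 [fr3 s3T kp3 f3].
have e3 : env n s3 by apply: env_frame4 e2 => y y4; apply: fr3; clear -y4; lia.
have [s3N s3B s3I s31] := e3.
have s3U : regs s3 rU = u by rewrite fr3.
have s3P : regs s3 rP = p by rewrite fr3.
(* Unlinking and pushing only touch fields 0 to 2. *)
have f3s (v : nat) c : c < 32 -> 2 < c -> fld n s3 v c = fld n s v c.
  move=> c32 c2; rewrite f3 // [c == 2](_ : _ = false) ?andbF; last by clear -c2; lia.
  rewrite f2 // [c == 0](_ : _ = false); last by clear -c2; lia.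
  rewrite [c == 1](_ : _ = false); last by clear -c2; lia.
  by rewrite mul0n muln0 subn0 f0.
have tab3 (v : 'I_n) t : t < 5 -> fld n s3 v (fTab + t) = tab s v t.
  by move=> t5; rewrite f3s //; clear -t5; lia.
apply: halts_seq; apply: halts_weaken (merge_spec n0 hW s3B s3I _ _ _ _ _) _;
  rewrite ?s3U ?s3P //.
- by move=> t t5; rewrite tab3 ?tabK.
- by move=> t t5; rewrite tab3 ?tabK.
move=> s4 [fr4 kp4 old4 le4 ch4].
have e4 := env_frame fr4 e3; have [s4N s4B s4I s41] := e4.
have s4J : regs s4 rI = j by rewrite fr4 // fr3 // fr2 // /s0 !writeE.
have s4K : regs s4 rK = k.+1 by rewrite fr4 // fr3 // fr2 // /s0 !writeE.
apply/halts_seq/halts_add; rewrite s4J s41 addn1; first by clear -jn W1; lia.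
apply/halts_seq/halts_sub; rewrite !writeE /= s4K s41 subn1 /=; first by clear -szus W1; lia.
apply: halts_skip; set s5 := write_reg _ _ _.
have f5 v c : fld n s5 v c = fld n s4 v c by rewrite /fld /s5 !writeE.
have cardX' : #|X :\ u| = k.+1.
  by move: cardX; rewrite (cardsD1 u) uX => -[].
have low3 (v : nat) c : c < 3 -> fld n s4 v c = fld n s3 v c.
  by move=> c3; apply: old4; clear -c3; lia.
have tab5 (v : 'I_n) t : t < 5 -> v != p -> tab s5 v t = tab s v t.
  move=> t5 vp; rewrite /tab f5 old4 ?tab3 //; try by clear -t5; lia.
  by rewrite -(inj_eq val_inj) /= in vp; rewrite (negbTE vp).
have mrg : merged n.*2.+1 X (tab s) (tab s5) u p
    (fun r => fld n s5 u (fOwn + r)) (fun r => fld n s5 u (fSub + r)).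
  split.
  - by move=> v _ t; apply: tab5.
  - move=> a t r a5 t5 atr; rewrite /tab f5.
    by have := le4 a t r a5 t5 atr; rewrite !tab3.
  move=> r r5; rewrite /tab !f5 => lt; have [_ /(_ lt)] := ch4 r r5.
  by case=> a5 t5 atr ->; split; rewrite ?tab3.
exists (u :: us), (X :\ u), (if b then rcons q p else q); split.
- split; rewrite /env /s5 ?writeE //=.
  by rewrite addSnnS.
- split=> //; first exact: connected_in_leaf lf cX.
    by move=> v; rewrite !inE XE negb_or.
  by exists p; rewrite // /s5 !writeE /= fr4 // s3P.
- split.
    move=> v vX'; have vX : v \in X by move: vX'; rewrite inE => /andP[].
    rewrite !f5 !low3 // !f3 ?andbF // !f2 // !f0 !(cnt v vX).1 !(cnt v vX).2.
    rewrite (card_nbrsD1 lf vX') (sum_nbrsD1 lf vX') -(inj_eq val_inj) /=.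
    by case: eqP => _ /=; rewrite ?mul1n ?mul0n ?muln0 ?addn0 ?add0n ?subn0 ?addnK.
  have qs' : queue (if b then rcons q p else q) s5.
    have qs2 : queue q s2.
      apply: queue_eq qs _ _ => [|i]; first by rewrite s2T qT.
      by rewrite f2 // muln0 subn0 f0.
    apply: (@queue_eq _ _ s3) => [||i]; last by rewrite f5 low3.
      apply: queue_push qs2 pq _ _; first by rewrite s3T s2T.
      by move=> i; rewrite f3 // andbT s2T.
    by rewrite /s5 !writeE fr4.
  split=> //.
    rewrite rev_cons usE (_ : size (u :: us) = j.+1) //.
    transitivity (take j.+1 q); first by rewrite (take_nth (Ordinal n0)).
    case: (b) => //; rewrite -cats1 take_cat.
    case: ltnP => // qj; have -> : j.+1 - size q = 0 by clear -jq; lia.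
    by rewrite take0 cats0 take_oversize.
  move=> v vX'; have vX : v \in X by move: vX'; rewrite inE => /andP[].
  have [dq qd] := qX v vX; have := card_nbrsD1 lf vX'.
  have [->|vp] := eqVneq v p => /= dE.
    rewrite /b; case: eqP => [d1|d1]; rewrite ?mem_rcons ?mem_head; split=> //.
      by rewrite d1.
    by move/(qX p pX).2; rewrite degp addn1 ltnS leqn0 => /eqP->.
  rewrite addn0 in dE; rewrite -dE.
  by case: (b); rewrite // mem_rcons inE (negbTE vp).
- move=> v t t5; have [->|vp] := eqVneq v p; last by rewrite tab5 ?tabK.
  by rewrite /tab f5; have [] := ch4 t t5.
split; first exact: (lower_merged lf mrg low).
exists X, (tab s), p; split=> //.
  have other (w : 'I_n) : w \in us -> (w != u) && (w != p).
    by move=> wus; apply/andP; split; apply: contraTneq wus => ->; rewrite -XE.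
  have us_f w c : w \in us -> 2 < c < 32 -> fld n s5 w c = fld n s w c.
    move=> /other; rewrite -!(inj_eq val_inj) /= => wup c32.
    by rewrite f5 old4 ?f3s //; clear -wup c32; lia.
  apply: trace_frame tr => w wus.
    have /other := wus; rewrite -!(inj_eq val_inj) /= => /andP[_ /negbTE wp].
    by rewrite f5 low3 // f3 // !andbF f2 // wp mul0n subn0 f0.
  by move=> r r5; rewrite !us_f //; clear -r5; lia.
rewrite f5 low3 // f3 // !andbF f2 // f0 fu1.
have -> : ((u : nat) == p) = false by apply: negbTE; rewrite (inj_eq val_inj).
by rewrite mul0n subn0.
Qed.

End Pruning.

(** * Reconstruction and output *)

Lemma solves_ext (V : finType) (G : sgraph V) X A S S' t :
  S =1 S' -> solves G X A S t -> solves G X A S' t.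
Proof.
move=> SS' [S5 DS St]; split; last by rewrite -St; apply: eq_bigr => v _; rewrite SS'.
  by move=> v vX; rewrite -SS' S5.
move=> v vX; rewrite -SS'; case: (DS v vX) => [|[w wX h]]; [by left | right].
by exists w => //; rewrite /helps -!SS'.
Qed.

Section Answer.

Variables (n W : nat) (T : sgraph 'I_n) (es : seq ('I_n * 'I_n)).
Hypotheses (hW : 64 * n.+1 ^ 2 <= W) (treeT : is_tree T) (esT : edge_list T es).
Let n0 : 0 < n := tree_order_gt0 treeT.

Definition sol s (v : 'I_n) := fld n s v fSol.

(** Invariant of the backward loop: the [k] prunings that are not undone yet
    lead to a labelled tree whose table sum is still at most gamma. *)
Definition backtracking k s : Prop := exists us X A,
  [/\ env n s /\ regs s rK = k, size us = k /\ k <= n.-1,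
      forall i, i < k -> fld n s i fQueue = nth 0 (map val (rev us)) i,
      trace n.*2.+1 T (fld n s) us X A
    & exists2 t, t <= gammaB2 T & solves T X A (sol s) t].

Lemma gammaB2_le : gammaB2 T <= n.
Proof.
have [_ /(_ _ (dominating_all_one T))] := gammaB2P T.
rewrite /cost (eq_bigr (fun=> 1)) ?sum_nat_const ?card_ord ?muln1 // => v _.
by rewrite ffunE inordK.
Qed.

(** What both programs share: one vertex is left, and [rX] holds the least
    admissible entry of its table. *)
Definition solved s : Prop := env n s /\ exists us r A,
  [/\ size us = n.-1, forall i, i < n.-1 -> fld n s i fQueue = nth 0 (map val (rev us)) i,
      trace n.*2.+1 T (fld n s) us [set r] A,
      regs s rX <= gammaB2 T
    & solves T [set r] A (sol s) (regs s rX)].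

Lemma select_ok s : pruned T 0 s -> halts W select_code s solved.
Proof.
have [W1 W2] := big_word n0 hW; have nW : n.*2.+1 <= W by clear -W1; lia.
case=> us [X [q [[e sK sI szus] [cX cardX XE [r rinX rPr]] [_ [qs usE qX]] tabK [low tr]]]].
have [sN sB sInf s1] := e.
have {}XE : X = [set r].
  by move/eqP/cards1P: cardX rinX => [y ->]; rewrite inE => /eqP->.
rewrite XE in low tr.
apply: halts_weaken (select_spec n0 hW sB _ _) _; rewrite ?rPr //.
  by move=> t t5; apply: leq_trans nW; apply: tabK.
move=> s' [fr kp old [sol5 solE] opt].
split; first exact: env_frame fr e.
exists us, r, (tab s); split.
- by rewrite -szus addn0.
- move=> i ik; have [q_u _ qE] := qs.
  have ius : i < size us by rewrite -(addn0 (size us)) szus.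
  have us_q : size us <= size q.
    by have := congr1 size usE; rewrite size_rev size_take_min => us_q; apply/minn_idPl.
  by rewrite old ?andbF // qE ?(leq_trans ius) // usE map_take nth_take.
- apply: trace_frame tr => v vus; first by rewrite old ?andbF.
  by move=> t t5; rewrite !old //; clear -t5; lia.
- by rewrite opt; apply: lower_root low.
have Sr : sol s' r < 5 by case/andP: sol5.
split.
- by move=> v /set1P->.
- by apply/settled1; case/andP: sol5.
by rewrite big_set1 -solE.
Qed.

Lemma back_setup_ok s : solved s -> halts W back_setup s (backtracking n.-1).
Proof.
have [W1 W2] := big_word n0 hW.
case=> e [us [r [A [szus qE tr le sol_s]]]]; have [sN sB sInf s1] := e.
apply/halts_seq/halts_sub; first by rewrite sN; clear -W1; lia.
apply: halts_skip; set s' := write_reg _ _ _.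
have ff v c : fld n s' v c = fld n s v c by rewrite /fld /s' !writeE.
exists us, [set r], A; split=> //.
- by split; rewrite /env /s' !writeE //= sN s1 subn1.
- by move=> i ik; rewrite ff qE.
- by apply: trace_frame tr => v *; rewrite !ff.
by exists (regs s rX) => //; apply: solves_ext sol_s => v; rewrite /sol ff.
Qed.

Lemma back_ok k s : backtracking k.+1 s -> halts W back_body s (backtracking k).
Proof.
case=> -[|u us] [X [A [[e sK] [//= [szus] kn] qE]]] [X' [A' [p [tr lf up XE mrg]]]].
case=> t tg sol_s; have [sN sB sInf s1] := e; rewrite XE in sol_s.
have tK : t < n.*2.+1.
  by apply: leq_ltn_trans tg _; have := gammaB2_le; clear; lia.
have sol' := solves_merged lf mrg tK sol_s.
have [S5 _ St] := sol_s; have [S5' _ _] := sol'.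
have [uX pX _] := lf; have upN := leaf_neq lf.
have pX' : p \in X' :\ u by rewrite !inE eq_sym upN.
have k2 : fld n s k fQueue = u.
  rewrite qE // rev_cons map_rcons nth_rcons size_map size_rev szus.
  by rewrite ltnn eqxx.
have := S5' u uX; have := S5' p pX; rewrite eqxx eq_sym (negbTE upN) eqxx => own5 sub5.
have nn : n.-1 < n by rewrite prednK.
apply: halts_weaken (back_spec n0 hW sB s1 _ _ _ _ _ _ _ _) _; rewrite sK ?k2 ?up //=.
- by apply: leq_trans kn _; apply: ltnW.
- exact: S5 p pX'.
move=> s' [fr s'K kp]; rewrite ?k2 ?up => f.
have e' := env_frame4 fr e.
have old v c : c < 32 -> c != 3 -> fld n s' v c = fld n s v c.
  by move=> c32 /negbTE c3; rewrite f // c3 !andbF.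
exists us, X', A'; split=> //.
- by split=> //; apply: ltnW.
- move=> i ik; rewrite old // qE; last exact: ltnW.
  rewrite rev_cons map_rcons nth_rcons size_map size_rev szus.
  by rewrite ik.
- apply: trace_frame tr => v vus; first by rewrite old.
  by move=> c c5; rewrite !old //; clear -c5; lia.
exists t => //; apply: solves_ext sol' => v.
by rewrite /sol f // !andbT.
Qed.

(** Output cells have addresses below [n] and thus lie outside the records. *)
Definition printing k s : Prop :=
  [/\ env n s /\ regs s rK = k, k <= n /\ regs s rI = n - k
    & exists t A,
    [/\ t <= gammaB2 T, forall v c, c < 5 -> A v c = leaf_table n.*2.+1 c,
        solves T setT A (sol s) t
      & forall v : 'I_n, v < n - k -> heap s v = sol s v - 2]].

Lemma out_setup_ok s : backtracking 0 s -> halts W out_setup s (printing n).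
Proof.
have [W1 W2] := big_word n0 hW.
case=> us [X [A [[e sK] [us0 _] _ + [t tg sol_s]]]]; have [sN sB sInf s1] := e.
rewrite (size0nil us0) => -[XE AE]; rewrite XE in sol_s.
rewrite /out_setup /=; apply/halts_seq/halts_move; first by rewrite sN; clear -W1; lia.
apply/halts_seq/halts_const => //; apply: halts_skip; split.
- by split; rewrite /env !writeE.
- by split; rewrite // writeE subnn.
exists t, A; split=> //; last by move=> v; rewrite subnn.
by apply: solves_ext sol_s => v; rewrite /sol /fld !writeE.
Qed.

Lemma out_ok k s : printing k.+1 s -> halts W out_body s (printing k).
Proof.
case=> -[e sK] [kn sI] [t [A [tg AE sol_s out]]].
have [sN sB sInf s1] := e; have [S5 _ _] := sol_s.
have vn : n - k.+1 < n by clear -kn; lia.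
apply: halts_weaken (out_spec n0 hW sB s1 _ _ _ _) _; rewrite ?sK ?sI //.
  exact: (S5 (Ordinal vn)).
move=> s' [fr s'K s'I hp].
have nk : n - k = (n - k.+1).+1 by clear -kn; lia.
have ff (v : 'I_n) : sol s' v = sol s v.
  by rewrite /sol /fld hp eq_sym input_neq_cell //; clear -vn; lia.
split.
- by split=> //; apply: env_frame4 fr e.
- by rewrite nk s'I; split=> //; apply: ltnW.
exists t, A; split=> //; first by apply: solves_ext sol_s => v; rewrite ff.
move=> v; rewrite nk ltnS leq_eqVlt hp ff => /orP[/eqP vE|vk].
  by rewrite vE eqxx /sol vE.
by rewrite ltn_eqF // out.
Qed.

Definition solve_prog :=
  CSeq (loop setup edge_body) (CSeq (loop table_setup table_body)
    (CSeq (loop prune_setup prune_body) select_code)).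

Definition loop_cost su b := max_steps su + max_steps b + 2.

Definition solve_cost :=
  loop_cost setup edge_body + (loop_cost table_setup table_body
    + (loop_cost prune_setup prune_body + max_steps select_code)).

Lemma runs_weaken p s t1 t2 (Q R : state -> Prop) :
  runs W p s t1 R -> t1 <= t2 -> (forall s', R s' -> Q s') -> runs W p s t2 Q.
Proof.
case=> t [s' [ex le r]] le2 RQ; exists t, s'; split=> //; last exact: RQ.
exact: leq_trans le le2.
Qed.

Lemma runs_loop_cost su b s k (I : nat -> state -> Prop) :
  loopfree su -> loopfree b -> k <= n -> halts W su s (I k) ->
  (forall k s, I k s -> regs s rK = k) ->
  (forall k s, I k.+1 s -> halts W b s (I k)) ->
  runs W (loop su b) s (loop_cost su b * n) (I 0).
Proof.
move=> lsu lb kn Is Ir Ib; apply: runs_weaken (runs_loop lsu lb kn Is Ir Ib) _ _ => //.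
by rewrite /loop_time /loop_cost; move: (max_steps su) (max_steps b) => a c; clear -n0; nia.
Qed.

Lemma solve_ok : runs W solve_prog (init es) (solve_cost * n) solved.
Proof.
have distr a b c d : (a + (b + (c + d))) * n = a * n + (b * n + (c * n + d * n)).
  by rewrite !mulnDl.
rewrite distr; apply: runs_seq; apply: runs_weaken (leqnn _) _.
  apply: (runs_loop_cost (I := edges_read es)) (setup_spec hW treeT esT) _ _ => //.
  - exact: leq_pred.
  - by move=> k s [? [? [_ _ []]]].
  - by move=> k s; exact: (edge_spec hW treeT esT).
move=> s1 I1; apply: runs_seq; apply: runs_weaken (leqnn _) _.
  apply: (runs_loop_cost (I := tables_ready T)) (table_setup_spec hW treeT esT I1) _ _ => //.
  - by move=> k s [[]].
  - by move=> k s; exact: (table_spec hW treeT).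
move=> s2 I2; apply: runs_seq; apply: runs_weaken (leqnn _) _.
  apply: (runs_loop_cost (I := pruned T)) (prune_setup_spec hW treeT I2) _ _ => //.
  - exact: leq_pred.
  - by move=> k s [? [? [? [[]]]]].
  - by move=> k s; exact: (prune_spec hW treeT).
move=> s3 I3; apply: runs_weaken (runs_halts _ (select_ok I3)) _ _ => //.
exact: leq_pmulr.
Qed.

(** The logical counterpart of the backward loop, for the program that computes
    the cost only. *)
Lemma trace_solves m us X A S t : t < n.*2.+1 ->
  trace n.*2.+1 T m us X A -> solves T X A S t ->
  exists A0 S0, (forall v c, c < 5 -> A0 v c = leaf_table n.*2.+1 c)
                /\ solves T setT A0 S0 t.
Proof.
move=> tK; elim: us X A S => [|u us IH] X A S /=.
  by case=> -> AE sol_S; exists A, S.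
case=> X' [A' [p [tr lf _ -> mrg]]] sol_S.
exact: IH tr (solves_merged lf mrg tK sol_S).
Qed.

Lemma solved_cost s : solved s -> regs s rX = gammaB2 T.
Proof.
case=> _ [us [r [A [_ _ tr le sol_s]]]]; apply/eqP; rewrite eqn_leq le /=.
have tK : regs s rX < n.*2.+1.
  by apply: leq_ltn_trans le _; have := gammaB2_le; clear; lia.
have [A0 [S0 [AE sol0]]] := trace_solves tK tr sol_s.
have [domf <- _] := solves_init treeT.1 AE tK sol0.
by have [_ ->] := gammaB2P T.
Qed.

Definition output_cost := block [:: CInstr (IConst rA 0); CInstr (IStore rA rX)].

Lemma output_cost_ok s : solved s ->
  halts W output_cost s (fun s' => heap s' 0 = gammaB2 T).
Proof.
move=> /solved_cost sE; apply/halts_seq/halts_const => //.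
apply/halts_seq/halts_store; apply: halts_skip.
by rewrite !writeE /= sE.
Qed.

Definition output_broadcast := CSeq (loop back_setup back_body) (loop out_setup out_body).

Lemma output_broadcast_ok s : solved s ->
  runs W output_broadcast s
    ((loop_cost back_setup back_body + loop_cost out_setup out_body) * n)
    (fun s' => exists f : {ffun 'I_n -> 'I_3},
      [/\ dominating T f, cost f = gammaB2 T & forall v : 'I_n, heap s' v = f v]).
Proof.
move=> I1; rewrite mulnDl; apply: runs_seq; apply: runs_weaken (leqnn _) _.
  apply: (runs_loop_cost (I := backtracking)) (back_setup_ok I1) _ _ => //.
  - exact: leq_pred.
  - by move=> k s' [? [? [? [[]]]]].
  - by move=> k s'; apply: back_ok.
move=> s2 I2; apply: runs_weaken (leqnn _) _.
  apply: (runs_loop_cost (I := printing)) (out_setup_ok I2) _ _ => //.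
  - by move=> k s' [[]].
  - by move=> k s'; apply: out_ok.
move=> s3 [[e _] _ [t [A [tg AE sol3 out]]]].
have tK : t < n.*2.+1.
  by apply: leq_ltn_trans tg _; have := gammaB2_le; clear; lia.
have [domf costf fE] := solves_init treeT.1 AE tK sol3.
exists [ffun v => inord (sol s3 v - 2)]; split=> //.
  apply/eqP; rewrite eqn_leq {1}costf tg.
  by have [_ ->] := gammaB2P T.
by move=> v; rewrite out ?fE // subn0.
Qed.

End Answer.

(** As [n + 1] is at least 2, six of the eight factors give the constant 64,
    which makes room for addresses up to [34 * n] and for sums of neighbours,
    which are quadratic. *)
Lemma word_bound n W : n.+1 ^ 8 <= W -> 0 < n -> 64 * n.+1 ^ 2 <= W.
Proof.
move=> hW n0; apply: leq_trans hW; rewrite (expnD _ 6 2) leq_mul2r.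
by rewrite (@leq_exp2r 2 n.+1 6) ?orbT.
Qed.

Theorem mainTheorem2 :
  linear_time_on_trees
    (fun (n : nat) (T : sgraph 'I_n) (out : nat -> nat) =>
       out 0 = gammaB2 T)
  /\
  linear_time_on_trees
    (fun (n : nat) (T : sgraph 'I_n) (out : nat -> nat) =>
       exists f : {ffun 'I_n -> 'I_3},
         [/\ dominating T f, cost f = gammaB2 T
           & forall v : 'I_n, out v = f v]).
Proof.
split.
  exists (CSeq solve_prog output_cost), (solve_cost + max_steps output_cost), 8.
  move=> n T es W treeT esT /word_bound hW.
  have n0 := tree_order_gt0 treeT; have {}hW := hW n0.
  have [|t [s [ex le out]]] := @runs_seq W solve_prog output_cost (init es)
    (solve_cost * n) (max_steps output_cost * n) (fun s => heap s 0 = gammaB2 T).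
    apply: runs_weaken (solve_ok hW treeT esT) (leqnn _) _ => s sol_s.
    by apply: runs_weaken (runs_halts _ (output_cost_ok _ treeT sol_s)) (leq_pmulr _ n0) _.
  by exists t, s; split=> //; rewrite mulnDl.
exists (CSeq solve_prog output_broadcast),
  (solve_cost + (loop_cost back_setup back_body + loop_cost out_setup out_body)), 8.
move=> n T es W treeT esT /word_bound hW.
have n0 := tree_order_gt0 treeT; have {}hW := hW n0.
have [t [s [ex le out]]] := @runs_seq W solve_prog output_broadcast (init es)
  (solve_cost * n) _ _ (runs_weaken (solve_ok hW treeT esT) (leqnn _)
     (fun s sol_s => output_broadcast_ok hW treeT sol_s)).
by exists t, s; split=> //; rewrite mulnDl.
Qed.
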